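(* For every $r>0$ there is a constant $C(r)>0$ such that for all $\delta\in\mathbb{R}^N$ with $|\delta|<r$ and all $J\in\mathbb{N}$, $$d_{\mathrm{Hell}}(\gamma^{J,\delta},\gamma^\delta)\le C(r)\,J^{-q},\qquad q=p-1.$$
   Context: Let $\Omega\subset\mathbb{R}^d$ be a bounded Lipschitz domain and $x_0\in\Omega$. Let $s_*,\overline{s},\psi_i\in L^\infty(\Omega)$ ($i\in\mathbb{N}=\{1,2,\dots\}$) with $s_*\ge 0$, and put $b_i=\|\psi_i\|_{L^\infty(\Omega)}$. Assume there are constants $c>0$ and $p>1$ with $b_i<c\,i^{-p}$ for all $i$. Let $U=\{u=(u_1,u_2,\dots)\in\mathbb{R}^{\mathbb{N}}:\sum_{i=1}^\infty|u_i|b_i<\infty\}$, let $\Theta$ be the restriction to $U$ of the product $\sigma$-algebra $\bigotimes_{i=1}^\infty\mathcal{B}(\mathbb{R})$, and let the prior $\gamma$ be the restriction to $U$ of the product Gaussian measure $\bigotimes_{i=1}^\infty\mathcal{N}(0,1)$; $\gamma(U)=1$. The slowness function and its truncation are $$s(x,u)=s_*(x)+\exp\Big(\overline{s}(x)+\sum_{i=1}^\infty u_i\psi_i(x)\Big),\qquad s^J(x,u)=s_*(x)+\exp\Big(\overline{s}(x)+\sum_{i=1}^J u_i\psi_i(x)\Big),$$ and $s(\cdot,u)$ is assumed continuous and positive on $\overline\Omega$ for each $u\in U$ (hence so is $s^J(\cdot,u)$). For $u\in U$, $T(\cdot,u)$ is the solution of the eikonal equation $|\nabla T(x,u)|=s(x,u)$,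 $T(x_0,u)=0$, with Soner boundary condition $\nabla T(x,u)\cdot n(x)\ge 0$ on $\partial\Omega$ ($n$ the outward unit normal); it is represented by $$T(x,u)=\inf_{\xi\in\Xi_{x_0}(x)}\int_0^1 s(\xi(r),u)|\xi'(r)|\,dr,\quad \Xi_{x_0}(x)=\{\xi\in W^{1,\infty}([0,1],\overline\Omega):\xi(0)=x_0,\ \xi(1)=x\}.$$ $T^J(\cdot,u)$ is the solution of the same problem with $s$ replaced by $s^J$ (same representation with $s^J$). Fix points $x^1,\dots,x^N\in\overline\Omega$; $G(u)=(T(x^1,u),\dots,T(x^N,u))$ and $G^J(u)=(T^J(x^1,u),\dots,T^J(x^N,u))$. Let $\Sigma$ be a positive definite $N\times N$ matrix, $|\cdot|$ the Euclidean norm, $|\cdot|_\Sigma=|\Sigma^{-1/2}\cdot|$, $\Phi(u,\delta)=\frac12|\delta-G(u)|_\Sigma^2$, $\Phi^J(u,\delta)=\frac12|\delta-G^J(u)|_\Sigma^2$. The probability measures $\gamma^\delta$ and $\gamma^{J,\delta}$ on $(U,\Theta)$ have densities with respect to $\gamma$ proportional to $\exp(-\Phi(u,\delta))$ and $\exp(-\Phi^J(u,\delta))$ respectively. For probability measures $\mu,\nu$ absolutely continuous with respect to $\gamma$, the Hellinger distance is $$d_{\mathrm{Hell}}(\mu,\nu)^2=\frac12\int_U\Big(\sqrt{\tfrac{d\mu}{d\gamma}}-\sqrt{\tfrac{d\nu}{d\gamma}}\Big)^2d\gamma.$$ *)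

(* Defs.v *)
From HB Require Import structures.
From mathcomp Require Import all_boot all_order all_algebra.
From mathcomp Require Import all_classical all_reals all_analysis.

Set Implicit Arguments.
Unset Strict Implicit.
Unset Printing Implicit Defensive.
Import Order.TTheory GRing.Theory Num.Theory.
Import numFieldNormedType.Exports.

Local Open Scope classical_set_scope.
Local Open Scope ring_scope.

(* The library norm on ['rV_n] is the sup norm; it induces the usual topology. *)
Definition enorm (R : realType) n (v : 'rV[R]_n) : R :=
  Num.sqrt (\sum_(i < n) v ord0 i ^+ 2).

Section measurable_rV.
Context (R : realType) (n : nat).

Definition rV_coord (i : 'I_n) (v : 'rV[R]_n) : R := v ord0 i.

Let rV_set0 : g_sigma_preimage rV_coord set0.
Proof. exact: sigma_algebra0. Qed.

Let rV_setC A : g_sigma_preimage rV_coord A -> g_sigma_preimage rV_coord (~` A).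
Proof. exact: sigma_algebraC. Qed.

Let rV_bigcup (F : _^nat) : (forall i, g_sigma_preimage rV_coord (F i)) ->
  g_sigma_preimage rV_coord (\bigcup_i (F i)).
Proof. exact: sigma_algebra_bigcup. Qed.

HB.instance Definition _ :=
  @isMeasurable.Build (measure_tuple_display default_measure_display)
    'rV[R]_n (g_sigma_preimage rV_coord) rV_set0 rV_setC rV_bigcup.

End measurable_rV.

Lemma measurable_rV_coord (R : realType) n (i : 'I_n) :
  measurable_fun [set: 'rV[R]_n] (rV_coord i).
Proof.
move=> _ A mA; apply: sub_sigma_algebra.
case: n i => [[]//|n] i; rewrite -bigcup_mkord_ord.
exists i; first exact: ltn_ord.
by exists A => //; rewrite inord_val.
Qed.

Lemma measurable_rV_coordP (R : realType) d (T : measurableType d) n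
    (f : T -> 'rV[R]_n) :
  (forall i, measurable_fun [set: T] (rV_coord i \o f)) ->
  measurable_fun [set: T] f.
Proof.
move=> mf; suff prefS : g_sigma_preimage (fun i => rV_coord i \o f) `<=` measurable.
  move=> _ A mA; apply: prefS; rewrite g_sigma_preimage_comp.
  by exists A.
apply: smallest_sub; first exact: sigma_algebra_measurable.
case: n => [|n] in f mf *; first by rewrite big_ord0.
rewrite -bigcup_mkord_ord; apply: bigcup_sub => i Ii.
by move=> A [B mB <-]; exact: mf.
Qed.

Section lebesgue_measure_rV.
Context (R : realType).

Definition rV_cons n (p : 'rV[R]_n * measurableTypeR R) : 'rV[R]_n.+1 :=
  row_mx (p.2%:M : 'rV_1) p.1.

Lemma measurable_rV_cons n : measurable_fun setT (@rV_cons n).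
Proof.
apply: measurable_rV_coordP => i.
have [j ->|j ->] := split_ordP (i : 'I_(1 + n)).
  apply: eq_measurable_fun measurable_snd => p _.
  by apply/esym/(etrans (row_mxEl _ _ _ _)); rewrite mxE (ord1 j) mulr1n.
apply: eq_measurable_fun (measurableT_comp (measurable_rV_coord j) measurable_fst).
by move=> p _; apply/esym/(etrans (row_mxEr _ _ _ _)).
Qed.

Section step.
Context n (mu : {measure set 'rV[R]_n -> \bar R}).

Definition lebesgue_rV_step : set 'rV[R]_n.+1 -> \bar R :=
  pushforward (mu \x (@lebesgue_measure R))%E (@rV_cons n).

Let mrV_cons := @measurable_rV_cons n.

Let step0 : lebesgue_rV_step set0 = 0%E.
Proof. exact: measure0. Qed.

Let step_ge0 A : (0 <= lebesgue_rV_step A)%E.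
Proof. exact: measure_ge0. Qed.

Let step_sigma_additive : semi_sigma_additive lebesgue_rV_step.
Proof. exact: measure_semi_sigma_additive. Qed.

HB.instance Definition _ := isMeasure.Build _ _ _ lebesgue_rV_step
  step0 step_ge0 step_sigma_additive.

End step.

Fixpoint lebesgue_rV n : {measure set 'rV[R]_n -> \bar R} :=
  if n is n'.+1 then lebesgue_rV_step (lebesgue_rV n') else \d_(0 : 'rV[R]_0).

End lebesgue_measure_rV.

(* The zero extension outside [D] leaves the essential supremum of |f| over [D]
   unchanged when [D] has positive measure. *)
Definition Linfty_norm d (T : measurableType d) (R : realType)
    (mu : {measure set T -> \bar R}) (D : set T) (f : T -> R) : \bar R :=
  'N[mu]_+oo[EFin \o (f \_ D)].

Definition Linfty d (T : measurableType d) (R : realType)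
    (mu : {measure set T -> \bar R}) (D : set T) (f : T -> R) : Prop :=
  measurable_fun D f /\ (Linfty_norm mu D f < +oo)%E.

Section sobolev.
Context (R : realType).

Definition test_function (phi : R -> R) : Prop :=
  (forall k r, derivable (phi^`(k))%classic r 1) /\
  exists a b : R, [/\ 0 < a, b < 1 & forall r, ~ (a <= r <= b) -> phi r = 0].

Definition weak_derivative (f g : R -> R) : Prop :=
  forall phi, test_function phi ->
    \int[lebesgue_measure]_(r in `]0, 1[) (f r * (phi^`())%classic r) =
    - \int[lebesgue_measure]_(r in `]0, 1[) (g r * phi r).

(* [f], given by its continuous representative on [0, 1], belongs to
   W^{1,oo}([0, 1]) and has weak derivative [g]. *)
Definition W1infty (f g : R -> R) : Prop :=
  [/\ {within `[0, 1], continuous f},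
      Linfty lebesgue_measure `]0, 1[ f,
      Linfty lebesgue_measure `]0, 1[ g & weak_derivative f g].

End sobolev.

(* R^d is ['rV_n.+1], i.e. d = n.+1 >= 1. Near each boundary point, in
   coordinates given by an orthogonal matrix [Q], the domain is the strict
   epigraph of a Lipschitz function of the first n coordinates. *)
Definition lipschitz_boundary (R : realType) n (Omega : set 'rV[R]_n.+1) : Prop :=
  forall z, (closure Omega `\` interior Omega) z ->
  exists (rho : R) (Q : 'M[R]_n.+1) (h : 'rV[R]_n -> R),
    [/\ 0 < rho,
        Q *m Q^T = 1%:M,
        (exists L : R, forall v w, `|h v - h w| <= L * enorm (v - w)) &
        forall y, enorm (y - z) < rho ->
          (Omega y <-> h (col' ord_max (y *m Q)) < (y *m Q) ord0 ord_max)].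

Definition bounded_lipschitz_domain (R : realType) n
    (Omega : set 'rV[R]_n.+1) : Prop :=
  [/\ open Omega, connected Omega, Omega !=set0, bounded_set Omega &
      lipschitz_boundary Omega].

Section eikonal.
Context (R : realType) (n : nat).
Implicit Types (Omega : set 'rV[R]_n.+1) (f g s : 'rV[R]_n.+1 -> R).

(* [xi] is a path in Xi_{x0}(x) and [dxi] is its weak derivative. *)
Definition admissible_path Omega (x0 x : 'rV[R]_n.+1)
    (xi dxi : R -> 'rV[R]_n.+1) : Prop :=
  [/\ forall i, W1infty (fun r => xi r ord0 i) (fun r => dxi r ord0 i),
      forall r, 0 <= r <= 1 -> closure Omega (xi r),
      xi 0 = x0 & xi 1 = x].

(* The solution of the eikonal equation with slowness [s], source [x0] and
   Soner boundary condition, through its variational representation. *)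
Definition travel_time Omega (x0 : 'rV[R]_n.+1) s (x : 'rV[R]_n.+1) : R :=
  inf [set c | exists xi dxi, admissible_path Omega x0 x xi dxi /\
    c = \int[lebesgue_measure]_(r in `[0, 1]) (s (xi r) * enorm (dxi r))].

(* [g] is a representative, continuous on the closure of [Omega], of the class
   of [f] modulo equality almost everywhere in [Omega]. It is uniquely
   determined on the closure of [Omega] when [Omega] is open. *)
Definition is_continuous_rep Omega f g : Prop :=
  {within closure Omega, continuous g} /\
  {ae lebesgue_rV R n.+1, forall x, Omega x -> g x = f x}.

Definition continuous_rep Omega f : 'rV[R]_n.+1 -> R :=
  xget (fun=> 0) [set g | is_continuous_rep Omega f g].

(* Sequences are indexed from 0: [psi i] and [u i] stand for psi_{i+1} and
   u_{i+1}. *)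
Definition slowness (s_star s_bar : 'rV[R]_n.+1 -> R)
    (psi : nat -> 'rV[R]_n.+1 -> R) (u : nat -> R) (x : 'rV[R]_n.+1) : R :=
  s_star x + expR (s_bar x + limn (series (fun i => u i * psi i x))).

Definition slowness_trunc (s_star s_bar : 'rV[R]_n.+1 -> R)
    (psi : nat -> 'rV[R]_n.+1 -> R) (J : nat) (u : nat -> R)
    (x : 'rV[R]_n.+1) : R :=
  s_star x + expR (s_bar x + \sum_(i < J) (u i * psi i x)).

Definition psi_norm Omega (psi : nat -> 'rV[R]_n.+1 -> R) (i : nat) : R :=
  fine (Linfty_norm (lebesgue_rV R n.+1) Omega (psi i)).

Definition forward_map Omega (x0 : 'rV[R]_n.+1) N (pts : 'I_N -> 'rV[R]_n.+1)
    f : 'rV[R]_N :=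
  \row_k travel_time Omega x0 (continuous_rep Omega f) (pts k).

End eikonal.

Section parameters.
Context (R : realType).

Definition cylinders : set (set (nat -> R)) :=
  [set A | exists (i : nat) (B : set R), measurable B /\ A = [set u | B (u i)]].

Definition RN := g_sigma_algebraType cylinders.

HB.instance Definition _ := Measurable.on RN.

(* The values on cylinders determine the product Gaussian measure on R^N. *)
Definition std_gaussian_product (P : probability RN R) : Prop :=
  forall (k : nat) (B : nat -> set R), (forall i, measurable (B i)) ->
    P [set u | forall i, (i < k)%N -> B i (u i)] =
    (\prod_(i < k) normal_prob 0 1 (B i))%E.

Definition weighted_summable (b u : nat -> R) : Prop :=
  (\sum_(0 <= i <oo) (`|u i| * b i)%:E < +oo)%E.

Record param_space (b : nat -> R) := ParamSpace {
  param_val :> nat -> R;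
  param_summable : weighted_summable b param_val }.

Lemma weighted_summable0 b : weighted_summable b (fun=> 0).
Proof.
by rewrite /weighted_summable eseries0// => i _ _; rewrite normr0 mul0r.
Qed.

HB.instance Definition _ b := gen_eqMixin (param_space b).
HB.instance Definition _ b := gen_choiceMixin (param_space b).
HB.instance Definition _ b :=
  isPointed.Build (param_space b) (ParamSpace (weighted_summable0 b)).

(* The preimages under the inclusion form the trace of the product
   sigma-algebra. *)
HB.instance Definition _ b := Measurable.copy (param_space b)
  (g_sigma_algebra_preimageType (@param_val b : param_space b -> RN)).

Definition restricted_prior b (P : probability RN R)
    (gamma : probability (param_space b) R) : Prop :=
  forall B : set RN, measurable B ->
    gamma [set u : param_space b | B u] = P (B `&` [set u | weighted_summable b u]).

End parameters.

Section misfit.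
Context (R : realType) (N : nat).

Definition posdefmx (S : 'M[R]_N) : Prop :=
  S^T = S /\ forall v : 'rV[R]_N, v != 0 -> 0 < (v *m S *m v^T) ord0 ord0.

(* Sigma^{-1/2}, which exists uniquely for positive definite [Sigma] *)
Definition inv_sqrtmx (Sigma : 'M[R]_N) : 'M[R]_N :=
  xget 0 [set S | posdefmx S /\ S *m S = invmx Sigma].

Definition weighted_norm (Sigma : 'M[R]_N) (v : 'rV[R]_N) : R :=
  enorm (v *m inv_sqrtmx Sigma).

Definition misfit (Sigma : 'M[R]_N) (G delta : 'rV[R]_N) : R :=
  2^-1 * weighted_norm Sigma (delta - G) ^+ 2.

End misfit.

Section density.
Context d (T : measurableType d) (R : realType).
Local Open Scope ereal_scope.
Local Open Scope charge_scope.

Definition density (mu gamma : probability T R) : T -> \bar R :=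
  'd (charge_of_finite_measure mu) '/d gamma.

Definition density_prop_to (gamma mu : probability T R) (w : T -> R) : Prop :=
  mu `<< gamma /\ exists Z : R, (0 < Z)%R /\
    {ae gamma, forall u, density mu gamma u = (w u / Z)%:E}.

Definition hellinger (gamma mu nu : probability T R) : \bar R :=
  sqrte ((2^-1)%:E * \int[gamma]_u
    (sqrte (density mu gamma u) - sqrte (density nu gamma u)) ^+ 2).

End density.

(* Main.v *)
Require Import Defs.
From HB Require Import structures.
From mathcomp Require Import all_boot all_order all_algebra.
From mathcomp Require Import all_classical all_reals all_analysis.
From mathcomp Require Import measurable_realfun ess_sup_inf ring lra.

Set Implicit Arguments.
Unset Strict Implicit.
Unset Printing Implicit Defensive.
Import Order.TTheory GRing.Theory Num.Theory.
Import numFieldNormedType.Exports.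

Local Open Scope classical_set_scope.
Local Open Scope ring_scope.

(** Let [a J u] be the weighted tail of [u] ([wtail]), the sum of
    [`|u i| * b i] over [J <= i], where [b i] bounds [`|psi i|] almost
    everywhere. The exponents of the slowness and of its truncation differ by at
    most [a J u], so each slowness is at most [expR (a J u)] times the other,
    first almost everywhere, then for the continuous representatives on the
    closure ([le_continuous_rep]).
    The admissible paths are the same for all slownesses, so that the same
    factor relates the travel times ([le_travel_time]), which are also bounded
    by a constant times [expR (a 0 u)] (comparison with the parameter 0). As the
    truncated slowness is the slowness of the truncated parameter, one
    comparison lemma, [travel_time_slowness_le], covers all these cases. Hence
    the square roots of the two unnormalized densities satisfy
      [(sqrt w - sqrt w_J)^2 <= K * a J u ^ 2 * expR (6 * a 0 u)],
    the constant [K] depending on [delta] only through the bound [r].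

    Two facts about the prior finish the proof. Its cylinder probabilities
    are products of Gaussian ones ([prior_cylinder]); a product rule for
    functions of the integer parts of the [`|u i|] yields exponential moments
    ([expectation_expR_le]), then a bound on the mean of
    [a J u ^ 2 * expR (6 * a 0 u)] by a constant times the square of the tail
    sum of [b] ([expectation_tail_le]), which is of order [J^(1 - p)]
    ([sum_powR_tail_le]). And [a 0 u] is at most some [m] with positive
    probability ([wsum_bounded_event]), which bounds the normalization constants
    from below ([normalization_ge]). The square of the Hellinger distance is at
    most the mean of [(sqrt w - sqrt w_J)^2] divided by this lower bound
    ([hellinger_le]).

    The densities are only compared through the Radon-Nikodym derivatives, whose
    measurability stands in for that of the forward map. *)

(** * Comparison of travel times *)

Section integral_comparison.
Context d (T : measurableType d) (R : realType).
Variable mu : {measure set T -> \bar R}.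
Import HBNNSimple.

(** The integral of a nonnegative function is the supremum of the integrals of
    the simple functions below it; scaling these by [k^-1] gives the bound for
    arbitrary, possibly nonmeasurable, integrands. *)
Lemma ge0_integral_le_scale (D : set T) (f g : T -> \bar R) (k : R) : 0 < k ->
  (forall x, D x -> 0 <= f x)%E -> (forall x, D x -> 0 <= g x)%E ->
  (forall x, D x -> f x <= k%:E * g x)%E ->
  (\int[mu]_(x in D) f x <= k%:E * \int[mu]_(x in D) g x)%E.
Proof.
move=> k0 f0 g0 fg; rewrite !ge0_integralE//.
apply: ge_ereal_sup => _ [h /= hf <-].
have k'0 : 0 <= k^-1 by rewrite invr_ge0 ltW.
rewrite -lee_pdivrMl// -sintegralrM; apply: ereal_sup_ubound => /=.
exists (scale_nnsfun h k'0) => //= x.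
have := hf x; rewrite /patch; case: ifPn => [/set_mem xD hx|_ hx].
- by rewrite EFinM lee_pdivrMl//; exact: le_trans hx (fg _ xD).
- by rewrite lee_fin mulr_ge0_le0.
Qed.

(** The comparison in both directions makes the two integrals finite together,
    hence the value 0 of [fine] at +oo is harmless. *)
Lemma Rintegral_le_scale (D : set T) (f g : T -> R) (k : R) : 0 < k ->
  (forall x, D x -> 0 <= f x) -> (forall x, D x -> 0 <= g x) ->
  (forall x, D x -> f x <= k * g x) -> (forall x, D x -> g x <= k * f x) ->
  \int[mu]_(x in D) f x <= k * \int[mu]_(x in D) g x.
Proof.
move=> k0 f0 g0 fg gf; rewrite /Rintegral.
have If := @integral_ge0 _ _ _ mu D (EFin \o f) f0.
have Ig := @integral_ge0 _ _ _ mu D (EFin \o g) g0.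
have fgI := @ge0_integral_le_scale D (EFin \o f) (EFin \o g) k k0 f0 g0 fg.
have gfI := @ge0_integral_le_scale D (EFin \o g) (EFin \o f) k k0 g0 f0 gf.
move: If Ig fgI gfI => /=.
case: (integral _ _ _) => [x| |]; case: (integral _ _ _) => [y| |] //=.
by rewrite mulr0.
Qed.

End integral_comparison.

Section travel_time_comparison.
Context (R : realType) (n : nat).
Implicit Types (Omega : set 'rV[R]_n.+1) (s : 'rV[R]_n.+1 -> R).

Lemma enorm_ge0 m (v : 'rV[R]_m) : 0 <= enorm v.
Proof. exact: sqrtr_ge0. Qed.

Lemma travel_time_ge0 Omega x0 s x : (forall y, closure Omega y -> 0 <= s y) ->
  0 <= travel_time Omega x0 s x.
Proof.
move=> s0; rewrite /travel_time; set S := (X in inf X).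
have [->|/set0P S0] := eqVneq S set0; first by rewrite inf0.
apply: lb_le_inf => // _ [xi [dxi [[_ cl _ _] ->]]].
apply: Rintegral_ge0 => t /=; rewrite in_itv/= => t01.
by rewrite mulr_ge0 ?enorm_ge0// s0//; exact: cl.
Qed.

(** The set of admissible paths does not depend on the slowness, so a pointwise
    comparison of slownesses passes to the cost of each path, then to infima.
    Without admissible path, both sides are 0, the infimum of the empty set. *)
Lemma le_travel_time Omega x0 s1 s2 k x : 0 < k ->
  (forall y, closure Omega y -> 0 <= s1 y) ->
  (forall y, closure Omega y -> 0 <= s2 y) ->
  (forall y, closure Omega y -> s1 y <= k * s2 y) ->
  (forall y, closure Omega y -> s2 y <= k * s1 y) ->
  travel_time Omega x0 s1 x <= k * travel_time Omega x0 s2 x.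
Proof.
move=> k0 s10 s20 s12 s21.
rewrite -ler_pdivrMl// {2}/travel_time; set S2 := (X in inf X).
have [S2e|/set0P S2n] := eqVneq S2 set0.
  rewrite S2e inf0 ler_pdivrMl// mulr0 /travel_time.
  set S1 := (X in inf X); suff -> : S1 = set0 by rewrite inf0.
  rewrite -subset0 => z [xi [dxi [adm _]]].
  suff: S2 (\int[lebesgue_measure]_(r in `[0, 1]) (s2 (xi r) * enorm (dxi r))).
    by rewrite S2e.
  by exists xi, dxi.
apply: lb_le_inf => // _ [xi [dxi [adm ->]]].
have [_ cl _ _] := adm; rewrite ler_pdivrMl//.
apply: (@le_trans _ _
    (\int[lebesgue_measure]_(r in `[0, 1]) (s1 (xi r) * enorm (dxi r)))).
  apply: ge_inf; last by exists xi, dxi.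
  exists 0 => _ [xi' [dxi' [[_ cl' _ _] ->]]].
  apply: Rintegral_ge0 => t /=; rewrite in_itv/= => t01.
  by rewrite mulr_ge0 ?enorm_ge0// s10//; exact: cl'.
apply: Rintegral_le_scale => // t /=; rewrite in_itv/= => /cl clt.
- by rewrite mulr_ge0 ?enorm_ge0 ?s10.
- by rewrite mulr_ge0 ?enorm_ge0 ?s20.
- by rewrite mulrA ler_wpM2r ?enorm_ge0 ?s12.
- by rewrite mulrA ler_wpM2r ?enorm_ge0 ?s21.
Qed.

End travel_time_comparison.

(** * Almost everywhere bounds and continuous representatives *)

Section continuous_representatives.
Context (R : realType).

Definition box n (c : 'rV[R]_n) (e : R) : set 'rV[R]_n :=
  [set v | forall i, `|c ord0 i - v ord0 i| < e].

Lemma measurable_box n (c : 'rV[R]_n) e : measurable (box c e).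
Proof.
rewrite (_ : box c e =
    \bigcap_(i in [set: 'I_n]) (rV_coord i @^-1` ball (c ord0 i) e)).
  apply: fin_bigcap_measurable => // i _; rewrite -[X in measurable X]setTI.
  by apply: measurable_rV_coord => //; rewrite ball_itv; exact: measurable_itv.
by apply/seteqP; split => [v cv i _|v cv i]; exact: cv.
Qed.

(** A box of dimension [n.+1] is the product of an interval and a box of
    dimension [n]. *)
Lemma lebesgue_rV_box n (c : 'rV[R]_n) e : 0 < e ->
  (0 < lebesgue_rV R n (box c e))%E.
Proof.
elim: n c => [|n IHn] c e0 /=.
  rewrite diracE mem_set ?lte01// => i; by case: i.
pose c' : 'rV[R]_n := \row_i c ord0 (lift ord0 i).
have -> : lebesgue_rV_step (lebesgue_rV R n) (box c e) =
    (lebesgue_rV R n \x (@lebesgue_measure R))%E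
      (box c' e `*` ball (c ord0 ord0) e).
  rewrite /lebesgue_rV_step/= /pushforward; congr (product_measure1 _ _ _).
  have rV0 (p : 'rV[R]_n * measurableTypeR R) : rV_cons p ord0 ord0 = p.2.
    rewrite /rV_cons (_ : ord0 = lshift n (ord0 : 'I_1)); last exact/val_inj.
    by apply: (etrans (row_mxEl _ _ _ _)); rewrite mxE/= mulr1n.
  have rVS (p : 'rV[R]_n * measurableTypeR R) i :
      rV_cons p ord0 (lift ord0 i) = p.1 ord0 i.
    rewrite /rV_cons (_ : lift ord0 i = rshift 1 i); last exact/val_inj.
    exact: row_mxEr.
  apply/seteqP; split => [p cp|p [cp1 cp2] i] /=.
    split => [i /=|]; last by have := cp ord0; rewrite rV0.
    by rewrite /c' mxE; have := cp (lift ord0 i); rewrite rVS.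
  have [j ->|->] := unliftP ord0 i; last by rewrite rV0.
  by rewrite rVS; have := cp1 j; rewrite /c' mxE.
rewrite product_measure1E; last 2 first.
- exact: measurable_box.
- by rewrite ball_itv; exact: measurable_itv.
rewrite mule_gt0 ?IHn//=.
by rewrite lebesgue_measure_ball ?ltW// lte_fin mulrn_wgt0.
Qed.

Variable n : nat.
Implicit Types (Omega : set 'rV[R]_n.+1) (f g : 'rV[R]_n.+1 -> R).

Lemma nbhs_box (x : 'rV[R]_n.+1) (A : set 'rV[R]_n.+1) :
  nbhs x A -> exists2 e, 0 < e & box x e `<=` A.
Proof.
move=> /nbhs_ballP[e /= e0 eA]; exists e => // v xv; apply: eA.
by split => // i j; rewrite ord1; exact: xv.
Qed.

Lemma lebesgue_rVT_gt0 : (0 < lebesgue_rV R n.+1 setT)%E.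
Proof.
apply: lt_le_trans (lebesgue_rV_box 0 ltr01) _.
by apply: le_measure; rewrite ?inE//; exact: measurable_box.
Qed.

(** Nonempty open sets contain a box, hence are not negligible. *)
Lemma open_ae_nonempty Omega (P : set 'rV[R]_n.+1) : open Omega ->
  Omega !=set0 -> {ae lebesgue_rV R n.+1, forall x, P x} ->
  exists2 x, Omega x & P x.
Proof.
move=> oO [x Ox] [N [mN N0 PN]]; apply: contrapT => noP.
have [e e0 eO] := nbhs_box (open_nbhs_nbhs (conj oO Ox)).
have: (lebesgue_rV R n.+1 (box x e) <= lebesgue_rV R n.+1 N)%E.
  apply: le_measure; rewrite ?inE//; first exact: measurable_box.
  move=> y xy; apply: PN => Py; apply: noP; exists y => //; exact: eO.
by rewrite N0 leNgt lebesgue_rV_box.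
Qed.

(** A strict inequality [g2 z < g1 z] at a point of the closure persists on a
    neighbourhood, which meets [Omega] in a nonempty open set, hence in a set
    of positive measure. *)
Lemma le_continuous_rep Omega g1 g2 : open Omega ->
  {within closure Omega, continuous g1} ->
  {within closure Omega, continuous g2} ->
  {ae lebesgue_rV R n.+1, forall x, Omega x -> g1 x <= g2 x} ->
  forall z, closure Omega z -> g1 z <= g2 z.
Proof.
move=> oO cg1 cg2 g12 z cz; rewrite leNgt; apply/negP => gz.
have /subspace_continuousP/(_ z cz) cd1 := cg1.
have /subspace_continuousP/(_ z cz) cd2 := cg2.
have gz0 : 0 < g1 z - g2 z by rewrite subr_gt0.
have := cvgr_gt _ (cvgB cd1 cd2) _ gz0; rewrite near_withinE => zV.
pose V := interior [set x | closure Omega x -> 0 < g1 x - g2 x].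
have oV : open V by exact: open_interior.
have Vz : V z by exact: zV.
have VP : V `<=` [set x | closure Omega x -> 0 < g1 x - g2 x].
  exact: interior_subset.
have [y [Oy Vy]] := cz V (open_nbhs_nbhs (conj oV Vz)).
have VO0 : (V `&` Omega) !=set0 by exists y.
have [x [Vx Ox] /(_ Ox)] := open_ae_nonempty (openI oV oO) VO0 g12.
by rewrite leNgt -subr_gt0 VP//; exact: subset_closure.
Qed.

End continuous_representatives.

(** * Dependence of the travel time on the parameter *)

Section weighted_sums.
Context (R : realType) (b : nat -> R).
Hypothesis b0 : forall i, 0 <= b i.
Implicit Types u : nat -> R.

Definition truncate (J : nat) (u : nat -> R) : nat -> R :=
  fun i => if (i < J)%N then u i else 0.

(** Valued in the extended reals, as it is to be defined on all sequences. *)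
Definition wtail (J : nat) u : \bar R :=
  (\sum_(J <= i <oo) (`|u i| * b i)%:E)%E.

Lemma wtail_ge0 J u : (0 <= wtail J u)%E.
Proof. by apply: nneseries_ge0 => i _ _; rewrite lee_fin mulr_ge0. Qed.

Lemma wtail_ge_partial J u k :
  ((\sum_(J <= i < k) `|u i| * b i)%:E <= wtail J u)%E.
Proof.
rewrite -sumEFin; apply: nneseries_lim_ge => i _ _.
by rewrite lee_fin mulr_ge0.
Qed.

Lemma wtail_le J u : (wtail J u <= wtail 0 u)%E.
Proof.
rewrite /wtail [leLHS]eseries_cond eseries_mkcondr.
apply: lee_nneseries => [i _ _|i _] /=.
- by case: ifP; rewrite // lee_fin mulr_ge0.
- by case: ifP => _; rewrite // lee_fin mulr_ge0.
Qed.

Lemma wtail_fin_num J u : weighted_summable b u -> wtail J u \is a fin_num.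
Proof.
move=> su; rewrite ge0_fin_numE ?wtail_ge0//.
exact: le_lt_trans (wtail_le _ _) su.
Qed.

Lemma wsum_le_fine u k : weighted_summable b u ->
  \sum_(i < k) `|u i| * b i <= fine (wtail 0 u).
Proof.
move=> su; rewrite -lee_fin fineK; last exact: wtail_fin_num.
by rewrite -(big_mkord xpredT (fun i => `|u i| * b i)) wtail_ge_partial.
Qed.

Lemma wsum_truncate_le u J k :
  \sum_(i < k) `|truncate J u i| * b i <= \sum_(i < k) `|u i| * b i.
Proof.
apply: ler_sum => i _; rewrite ler_wpM2r// /truncate; case: ifP => // _.
by rewrite normr0.
Qed.

Lemma wsum_truncateB_le u J k : weighted_summable b u ->
  \sum_(i < k) `|u i - truncate J u i| * b i <= fine (wtail J u).
Proof.
move=> su; rewrite -lee_fin fineK; last exact: wtail_fin_num.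
apply: le_trans (wtail_ge_partial J u k); rewrite lee_fin.
rewrite -(big_mkord xpredT (fun i => `|u i - truncate J u i| * b i)).
rewrite [leRHS](big_nat_widenl J 0)// [leRHS]big_mkcond/=.
apply: ler_sum => i _; rewrite /truncate ltnNge; case: (leqP J i) => _ /=.
  by rewrite subr0.
by rewrite subrr normr0 mul0r.
Qed.

Lemma truncate_summable u J : weighted_summable b u ->
  weighted_summable b (truncate J u).
Proof.
move=> su; apply: le_lt_trans su; apply: lee_nneseries => [i _ _|i _].
  by rewrite lee_fin mulr_ge0.
rewrite lee_fin ler_wpM2r// /truncate; case: ifP => // _.
by rewrite normr0.
Qed.

End weighted_sums.

Section exponential_comparison.
Context (R : realType).

Lemma expR_subr1_le (a : R) : expR a - 1 <= a * expR a.
Proof.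
have := expR_ge1Dx (- a); rewrite expRN => h.
rewrite lerBlDr -lerBlDl -{1}[expR a]mul1r -mulrBl.
by rewrite -ler_pdivlMr ?expR_gt0// mul1r.
Qed.

(** Each of [t], [t'] is at most [expR a] times the other, hence they differ
    by at most [expR a - 1 <= a * expR a] times their common bound. *)
Lemma dist_le_expR (t t' t0 a a0 : R) : 0 <= a -> a <= a0 -> 0 <= t0 ->
  t <= expR a * t' -> t' <= expR a * t ->
  t <= expR a0 * t0 -> t' <= expR a0 * t0 ->
  `|t - t'| <= a * expR a0 ^+ 2 * t0.
Proof.
move=> age0 aa0 t0_ge0 tt' t't tle t'le.
have ea : expR a - 1 <= a * expR a0.
  apply: le_trans (expR_subr1_le a) _.
  by rewrite ler_wpM2l// ler_expR.
have ea1 : 0 <= expR a - 1 by rewrite subr_ge0 -expR0 ler_expR.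
rewrite expr2 mulrA -[leRHS]mulrA.
have lem s : s <= expR a0 * t0 ->
    (expR a - 1) * s <= a * expR a0 * (expR a0 * t0).
  move=> sle; apply: le_trans (ler_wpM2l ea1 sle) _.
  by rewrite ler_wpM2r// mulr_ge0 ?expR_ge0.
rewrite ler_norml; apply/andP; split.
  rewrite lerNl opprB; apply: le_trans (lem _ tle).
  by rewrite mulrBl mul1r lerB.
apply: le_trans (lem _ t'le).
by rewrite mulrBl mul1r lerB.
Qed.

End exponential_comparison.

Section slowness_comparison.
Context (R : realType) (n : nat) (Omega : set 'rV[R]_n.+1).
Context (s_star s_bar : 'rV[R]_n.+1 -> R) (psi : nat -> 'rV[R]_n.+1 -> R).

Local Notation b := (psi_norm Omega psi).
Local Notation slow := (slowness s_star s_bar psi).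
Implicit Types u v : nat -> R.

Lemma psi_norm_ge0 i : 0 <= b i.
Proof. by rewrite fine_ge0// Lnorm_ge0. Qed.

Lemma ae_le_psi_norm : (forall i, Linfty (lebesgue_rV R n.+1) Omega (psi i)) ->
  {ae lebesgue_rV R n.+1, forall x, Omega x -> forall i, `|psi i x| <= b i}.
Proof.
move=> psiL; suff : {ae lebesgue_rV R n.+1,
    forall x, forall i, Omega x -> `|psi i x| <= b i}.
  by apply: filterS => x + Ox i; exact.
apply/ae_foralln => i; have [_ fin] := psiL i.
have : Linfty_norm (lebesgue_rV R n.+1) Omega (psi i) = (b i)%:E.
  by rewrite fineK// ge0_fin_numE// Lnorm_ge0.
rewrite /Linfty_norm unlock /Lnorm lebesgue_rVT_gt0 => bi.
have := ess_sup_ge (lebesgue_rV R n.+1)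
  (abse \o (EFin \o (psi i \_ Omega))).
rewrite bi; apply: filterS => x /=; rewrite lee_fin /patch => + Ox.
by rewrite mem_set.
Qed.

Lemma cvg_slowness_series u x : weighted_summable b u ->
  (forall i, `|psi i x| <= b i) -> cvgn (series (fun i => u i * psi i x)).
Proof.
move=> su psib; apply: normed_cvg.
apply: nondecreasing_is_cvgn.
  by apply: nondecreasing_series => i _ _; exact: normr_ge0.
exists (fine (wtail b 0 u)) => _ [k _ <-].
apply: le_trans (wsum_le_fine psi_norm_ge0 k su).
rewrite /normed_series_of/= /series/= big_mkord; apply: ler_sum => i _.
by rewrite normrM ler_wpM2l.
Qed.

(** The exponents of the two slownesses differ by at most [a]; the common
    nonnegative summand [s_star] can only bring their ratio closer to 1. *)
Lemma slowness_le u v a x : weighted_summable b u -> weighted_summable b v ->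
  (forall i, `|psi i x| <= b i) -> 0 <= s_star x ->
  (forall k, \sum_(i < k) `|u i - v i| * b i <= a) ->
  slow u x <= expR a * slow v x.
Proof.
move=> su sv psib s0 uva.
have a0 : 0 <= a by have := uva 0; rewrite big_ord0.
have cu := cvg_slowness_series su psib.
have cv := cvg_slowness_series sv psib.
rewrite /slowness mulrDr; apply: lerD.
  by rewrite ler_peMl// -expR0 ler_expR.
rewrite -expRD ler_expR addrCA lerD2l -lerBlDr -limB//.
apply: limr_le; first exact: is_cvgB.
apply: nearW => k; apply: le_trans (uva k).
rewrite /series/= !fctE !big_mkord -sumrB; apply: ler_sum => i _.
rewrite -mulrBl; apply: le_trans (ler_norm _) _.
by rewrite normrM ler_wpM2l.
Qed.

(** This makes the truncated problem an instance of the original one. *)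
Lemma slowness_truncE J u :
  slowness_trunc s_star s_bar psi J u = slow (truncate J u).
Proof.
apply/funext => x; rewrite /slowness_trunc /slowness; congr (_ + expR (_ + _)).
apply/esym/lim_near_cst => //; exists J => // k /= Jk.
rewrite /series/= (big_cat_nat (leq0n J) Jk)/= [X in _ + X]big_nat.
rewrite [X in _ + X]big1 ?addr0; last first.
  by move=> i /andP[Ji _]; rewrite /truncate ltnNge Ji mul0r.
by rewrite big_mkord; apply: eq_bigr => i _; rewrite /truncate ltn_ord.
Qed.

Context (x0 : 'rV[R]_n.+1).
Hypothesis oO : open Omega.
Hypothesis psiL : forall i, Linfty (lebesgue_rV R n.+1) Omega (psi i).
Hypothesis s_star0 :
  {ae lebesgue_rV R n.+1, forall x, Omega x -> 0 <= s_star x}.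
Hypothesis slow_rep : forall u : param_space b, exists g,
  is_continuous_rep Omega (slow u) g /\ forall x, closure Omega x -> 0 < g x.

Lemma slowness_continuous_rep (u : param_space b) :
  is_continuous_rep Omega (slow u) (continuous_rep Omega (slow u)).
Proof.
have [g [gu _]] := slow_rep u.
by rewrite /continuous_rep; case: xgetP => [f _ //|/(_ g)]; exact.
Qed.

Lemma continuous_rep_slowness_ge0 (u : param_space b) x :
  closure Omega x -> 0 <= continuous_rep Omega (slow u) x.
Proof.
have [cu eu] := slowness_continuous_rep u.
have c0 : {within closure Omega, continuous (fun=> 0 : R)}.
  by apply: continuous_subspaceT => y; exact: (@cst_continuous _ R).
apply: (le_continuous_rep oO c0 cu).
apply: filterS2 s_star0 eu => y s0 uy Oy.
by rewrite uy// addr_ge0 ?expR_ge0// s0.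
Qed.

(** The almost everywhere comparison of slownesses reaches every point of the
    closure, in particular the boundary, which the paths may follow. *)
Lemma continuous_rep_slowness_le (u v : param_space b) a x :
  (forall k, \sum_(i < k) `|u i - v i| * b i <= a) -> closure Omega x ->
  continuous_rep Omega (slow u) x <= expR a * continuous_rep Omega (slow v) x.
Proof.
move=> uva.
have [cu eu] := slowness_continuous_rep u.
have [cv ev] := slowness_continuous_rep v.
have cav : {within closure Omega,
    continuous (fun y => expR a * continuous_rep Omega (slow v) y)}.
  move=> y; apply: (@cvgM R (subspace (closure Omega)) (nbhs y) _
    (fun=> expR a)); [exact: cvg_cst|exact: cv].
apply: (le_continuous_rep oO cu cav).
apply: filterS2 (filterI s_star0 (ae_le_psi_norm psiL)) (filterI eu ev).
move=> y [s0 psib] [uy vy] Oy; rewrite uy// vy//.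
by apply: slowness_le; [exact: param_summable..|exact: psib|exact: s0|].
Qed.

Local Notation T u := (travel_time Omega x0 (continuous_rep Omega (slow u))).

Lemma travel_time_slowness_ge0 (u : param_space b) x : 0 <= T u x.
Proof. by apply: travel_time_ge0; exact: continuous_rep_slowness_ge0. Qed.

Lemma travel_time_slowness_le (u v : param_space b) a x :
  (forall k, \sum_(i < k) `|u i - v i| * b i <= a) -> T u x <= expR a * T v x.
Proof.
move=> uva; apply: le_travel_time.
- exact: expR_gt0.
- exact: continuous_rep_slowness_ge0.
- exact: continuous_rep_slowness_ge0.
- by move=> y; exact: continuous_rep_slowness_le.
- move=> y; apply: continuous_rep_slowness_le => k.
  by under eq_bigr do rewrite distrC.
Qed.

Definition param0 : param_space b := ParamSpace (weighted_summable0 b).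

Definition param_truncate J (u : param_space b) : param_space b :=
  ParamSpace (truncate_summable psi_norm_ge0 J (param_summable u)).

Lemma travel_time_le0 (u : param_space b) x :
  T u x <= expR (fine (wtail b 0 u)) * T param0 x.
Proof.
apply: travel_time_slowness_le => k; under eq_bigr do rewrite subr0.
by apply: wsum_le_fine; [exact: psi_norm_ge0|exact: param_summable].
Qed.

Lemma travel_time_truncate_le0 J (u : param_space b) x :
  T (param_truncate J u) x <= expR (fine (wtail b 0 u)) * T param0 x.
Proof.
apply: travel_time_slowness_le => k; under eq_bigr do rewrite subr0.
apply: le_trans (wsum_truncate_le psi_norm_ge0 _ _ _) _.
by apply: wsum_le_fine; [exact: psi_norm_ge0|exact: param_summable].
Qed.

Lemma travel_time_truncate_dist J (u : param_space b) x :
  `|T u x - T (param_truncate J u) x| <=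
  fine (wtail b J u) * expR (fine (wtail b 0 u)) ^+ 2 * T param0 x.
Proof.
set a := fine (wtail b J u); set a0 := fine (wtail b 0 u).
have aa0 : a <= a0.
  by apply: fine_le; rewrite ?wtail_fin_num ?wtail_le//;
    try exact: psi_norm_ge0; exact: param_summable.
have age0 : 0 <= a by rewrite fine_ge0// wtail_ge0//; exact: psi_norm_ge0.
have uJ k : \sum_(i < k) `|u i - param_truncate J u i| * b i <= a.
  exact: (wsum_truncateB_le psi_norm_ge0 J k (param_summable u)).
apply: dist_le_expR.
- exact: age0.
- exact: aa0.
- exact: travel_time_slowness_ge0.
- exact: travel_time_slowness_le.
- by apply: travel_time_slowness_le => k; under eq_bigr do rewrite distrC.
- exact: travel_time_le0.
- exact: travel_time_truncate_le0.
Qed.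

End slowness_comparison.

(** * Dependence of the likelihood on the forward map *)

Section misfit_bounds.
Context (R : realType) (N : nat).
Implicit Types (S : 'M[R]_N) (v w : 'rV[R]_N).

Lemma enorm_sqr m (v : 'rV[R]_m) : enorm v ^+ 2 = \sum_(i < m) v ord0 i ^+ 2.
Proof. by rewrite sqr_sqrtr// sumr_ge0// => i _; exact: sqr_ge0. Qed.

Lemma normr_le_enorm m (v : 'rV[R]_m) i : `|v ord0 i| <= enorm v.
Proof.
rewrite -sqrtr_sqr ler_wsqrtr// (bigD1 i)//= lerDl.
by apply: sumr_ge0 => j _; exact: sqr_ge0.
Qed.

(** A bound on the squared norm of [S] as an operator from the supremum norm to
    the Euclidean norm. *)
Definition mx_gain S : R := \sum_(j < N) (\sum_(i < N) `|S i j|) ^+ 2.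

Lemma mx_gain_ge0 S : 0 <= mx_gain S.
Proof. by apply: sumr_ge0 => j _; exact: sqr_ge0. Qed.

Lemma normr_mulmx_le S v m j : (forall i, `|v ord0 i| <= m) ->
  `|(v *m S) ord0 j| <= m * \sum_(i < N) `|S i j|.
Proof.
move=> vm; rewrite mxE; apply: le_trans (ler_norm_sum _ _ _) _.
by rewrite mulr_sumr; apply: ler_sum => i _; rewrite normrM ler_wpM2r.
Qed.

Lemma enorm_mulmx_le S v m : (forall i, `|v ord0 i| <= m) ->
  enorm (v *m S) ^+ 2 <= m ^+ 2 * mx_gain S.
Proof.
move=> vm; rewrite enorm_sqr mulr_sumr; apply: ler_sum => j _.
rewrite -exprMn -[leLHS]real_normK ?num_real// lerXn2r ?nnegrE//.
  exact: le_trans (normr_mulmx_le _ j vm).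
exact: normr_mulmx_le.
Qed.

(** A difference of squares is the product of a difference and a sum, and each
    of them is linear in [(v, w)]. *)
Lemma enorm_mulmx_dist S v w m e : (forall i, `|v ord0 i| <= m) ->
  (forall i, `|w ord0 i| <= m) -> (forall i, `|v ord0 i - w ord0 i| <= e) ->
  `|enorm (v *m S) ^+ 2 - enorm (w *m S) ^+ 2| <= 2 * e * m * mx_gain S.
Proof.
move=> vm wm vwe; rewrite !enorm_sqr -sumrB mulr_sumr.
apply: le_trans (ler_norm_sum _ _ _) _; apply: ler_sum => j _.
rewrite subr_sqr normrM.
have vw i : `|(v - w) ord0 i| <= e by rewrite !mxE.
have vw2 i : `|(v + w) ord0 i| <= 2 * m.
  by rewrite !mxE mulr2n mulrDl mul1r (le_trans (ler_normD _ _))// lerD.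
have -> : (v *m S) ord0 j - (w *m S) ord0 j = ((v - w) *m S) ord0 j.
  by rewrite mulmxBl !mxE.
have -> : (v *m S) ord0 j + (w *m S) ord0 j = ((v + w) *m S) ord0 j.
  by rewrite mulmxDl !mxE.
apply: le_trans (ler_pM _ _ (normr_mulmx_le S j vw) (normr_mulmx_le S j vw2)) _.
- by [].
- by [].
by rewrite expr2 le_eqVlt; apply/orP; left; apply/eqP; ring.
Qed.

Variable Sigma : 'M[R]_N.
Local Notation Q := (mx_gain (inv_sqrtmx Sigma)).

Lemma misfit_ge0 (G delta : 'rV[R]_N) : 0 <= misfit Sigma G delta.
Proof. by rewrite mulr_ge0 ?invr_ge0// sqr_ge0. Qed.

Lemma misfit_le (G delta : 'rV[R]_N) m :
  (forall k, `|delta ord0 k - G ord0 k| <= m) ->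
  misfit Sigma G delta <= m ^+ 2 * Q.
Proof.
move=> Gm; rewrite /misfit /weighted_norm ler_pdivrMl//.
apply: (@le_trans _ _ (m ^+ 2 * Q)).
  by apply: enorm_mulmx_le => k; rewrite !mxE.
by rewrite ler_peMl ?ler1n// mulr_ge0 ?sqr_ge0 ?mx_gain_ge0.
Qed.

Lemma misfit_dist (G G' delta : 'rV[R]_N) m e :
  (forall k, `|delta ord0 k - G ord0 k| <= m) ->
  (forall k, `|delta ord0 k - G' ord0 k| <= m) ->
  (forall k, `|G ord0 k - G' ord0 k| <= e) ->
  `|misfit Sigma G delta - misfit Sigma G' delta| <= e * m * Q.
Proof.
move=> Gm G'm GG'; rewrite /misfit /weighted_norm -mulrBr normrM.
rewrite ger0_norm ?invr_ge0// ler_pdivrMl//.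
rewrite !mulrA; apply: enorm_mulmx_dist => k; rewrite !mxE//.
rewrite [X in `|X|](_ : _ = - (G ord0 k - G' ord0 k)) ?normrN//.
by ring.
Qed.

Lemma normr_expRN_dist (x y : R) : 0 <= x -> 0 <= y ->
  `|expR (- x) - expR (- y)| <= `|x - y|.
Proof.
wlog xy : x y / x <= y => [wl|] x0 y0.
  have [/wl|/ltW/wl h] := leP x y; first exact.
  by rewrite distrC (distrC x); exact: h.
rewrite ger0_norm ?subr_ge0 ?ler_expR ?lerN2// ler0_norm ?subr_le0// opprB.
have -> : expR (- y) = expR (- x) * expR (x - y).
  by rewrite -expRD addrA (addrC (- x)) subrr add0r.
rewrite -[X in X - _]mulr1 -mulrBr.
have e1 : 1 - expR (x - y) <= y - x.
  by rewrite lerBlDr -lerBlDl opprB expR_ge1Dx.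
apply: le_trans (ler_wpM2l (expR_ge0 _) e1) _.
by rewrite ler_piMl ?subr_ge0// -expR0 ler_expR oppr_le0.
Qed.

Lemma sqrtr_expR (x : R) : Num.sqrt (expR x) = expR (x / 2).
Proof.
have {1}-> : x = x / 2 + x / 2 by rewrite -splitr.
by rewrite expRD -expr2 sqrtr_sqr ger0_norm ?expR_ge0.
Qed.

(** The square root of the likelihood is [expR (- misfit / 2)], and
    [x |-> expR (- x)] is 1-Lipschitz on nonnegative numbers. *)
Lemma sqrt_likelihood_dist (G G' delta : 'rV[R]_N) m e :
  (forall k, `|delta ord0 k - G ord0 k| <= m) ->
  (forall k, `|delta ord0 k - G' ord0 k| <= m) ->
  (forall k, `|G ord0 k - G' ord0 k| <= e) ->
  (Num.sqrt (expR (- misfit Sigma G delta)) -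
   Num.sqrt (expR (- misfit Sigma G' delta))) ^+ 2 <= (e * m * Q) ^+ 2.
Proof.
move=> Gm G'm GG'; rewrite !sqrtr_expR !mulNr.
rewrite -[leLHS]real_normK ?num_real//.
have d := misfit_dist Gm G'm GG'.
have emQ : 0 <= e * m * Q by exact: le_trans d.
rewrite lerXn2r ?nnegrE//; apply: le_trans (normr_expRN_dist _ _) _.
- by rewrite divr_ge0// misfit_ge0.
- by rewrite divr_ge0// misfit_ge0.
rewrite -mulrBl normrM [X in _ * X]ger0_norm ?invr_ge0// ler_pdivrMr//.
by apply: le_trans d _; rewrite ler_peMr// ler1n.
Qed.

End misfit_bounds.

(** * Exponential moments of independent Gaussian variables *)

Section normal_cells.
Context (R : realType).
Implicit Types (x : R) (phi : nat -> R).
Local Notation N01 := (normal_prob (0 : R) 1).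

Definition cell (n : nat) : set R := [set x | Num.truncn `|x| = n].

Lemma measurable_cell n : measurable (cell n).
Proof.
rewrite (_ : cell n = Num.norm @^-1` [set` `[n%:R, n.+1%:R[ ]).
  rewrite -[X in measurable X]setTI.
  by apply: normr_measurable => //; exact: measurable_itv.
apply/seteqP; split => x; rewrite /cell/= in_itv/=.
  by move/eqP; rewrite truncn_eq.
by move=> h; apply/eqP; rewrite truncn_eq.
Qed.

Lemma bigcup_cell : \bigcup_n cell n = [set: R].
Proof. by rewrite -subTset => x _; exists (Num.truncn `|x|). Qed.

Lemma trivIset_cell : trivIset setT cell.
Proof. by move=> i j _ _ [x [<- <-]]. Qed.

Lemma measurable_truncn_norm phi : measurable_fun [set: R]
  (fun x => phi (Num.truncn `|x|)).
Proof.
move=> _ Y mY; rewrite setTI.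
rewrite (_ : _ @^-1` Y = \bigcup_(n in phi @^-1` Y) cell n).
  by apply: bigcup_measurable => n _; exact: measurable_cell.
apply/seteqP; split => [x Yx|x [n /= Yn xn]] /=; last by rewrite xn.
by exists (Num.truncn `|x|).
Qed.

(** The expectation of [phi (truncn `|Z|)] for a standard normal [Z]. *)
Definition nmean phi : \bar R :=
  (\int[lebesgue_measure]_x (phi (Num.truncn `|x|) * normal_pdf 0 1 x)%:E)%E.

Lemma nmeanE phi : (forall n, 0 <= phi n) ->
  nmean phi = (\sum_(0 <= n <oo) (phi n)%:E * N01 (cell n))%E.
Proof.
move=> phi0; rewrite /nmean -bigcup_cell ge0_integral_bigcup; last 4 first.
- exact: measurable_cell.
- rewrite bigcup_cell; apply/measurable_EFinP/measurable_funM.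
    exact: measurable_truncn_norm.
  exact: measurable_normal_pdf.
- by move=> x _; rewrite lee_fin mulr_ge0// normal_pdf_ge0.
- exact: trivIset_cell.
apply: eq_eseriesr => n _; rewrite /normal_prob -ge0_integralZl_EFin//.
- by apply: eq_integral => x /set_mem <-; rewrite EFinM.
- exact: measurable_cell.
- by move=> x _; rewrite lee_fin normal_pdf_ge0.
- apply/measurable_funTS/measurable_EFinP; exact: measurable_normal_pdf.
Qed.

(** Completing the square: an exponential tilt of the Gaussian density is a
    translate of it. *)
Lemma normal_pdf_expR (t x : R) : expR (t * x) * normal_pdf 0 1 x =
  expR (t ^+ 2 / 2) * normal_pdf t 1 x.
Proof.
rewrite !normal_pdfE ?oner_eq0// /normal_fun mulrCA [RHS]mulrCA -!expRD.
by congr (_ * expR _); rewrite -[1 ^+ 2 *+ 2]mulr_natr; field.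
Qed.

Lemma measurable_expR_norm (t : R) :
  measurable_fun [set: R] (fun x : R => expR (t * `|x|)).
Proof.
by apply: measurableT_comp => //; apply: measurable_funM => //.
Qed.

Lemma integral_expR_normal (t : R) :
  (\int[lebesgue_measure]_x (expR (t * `|x|) * normal_pdf 0 1 x)%:E < +oo)%E.
Proof.
have mpdf m : measurable_fun [set: R] (fun x => (normal_pdf m 1 x)%:E).
  by apply/measurable_EFinP; exact: measurable_normal_pdf.
pose e := expR (t ^+ 2 / 2).
apply: (@le_lt_trans _ _ (\int[lebesgue_measure]_x
    (e%:E * (normal_pdf t 1 x)%:E + e%:E * (normal_pdf (- t) 1 x)%:E))%E).
  apply: ge0_le_integral => //=.
  - by move=> x _; rewrite lee_fin mulr_ge0 ?expR_ge0 ?normal_pdf_ge0.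
  - apply/measurable_EFinP/measurable_funM; last exact: measurable_normal_pdf.
    exact: measurable_expR_norm.
  - by apply: emeasurable_funD; apply: measurable_funeM; exact: mpdf.
  (* expR (t * `|x|) <= expR (t * x) + expR (- t * x) *)
  have e1 x : e * normal_pdf t 1 x = expR (t * x) * normal_pdf 0 1 x.
    by rewrite normal_pdf_expR.
  have e2 x : e * normal_pdf (- t) 1 x = expR (- t * x) * normal_pdf 0 1 x.
    by rewrite normal_pdf_expR sqrrN.
  move=> x _; rewrite -!EFinM -EFinD lee_fin e1 e2 -mulrDl.
  rewrite ler_wpM2r ?normal_pdf_ge0//.
  have [x0|x0] := leP 0 x.
    by rewrite ger0_norm// lerDl expR_ge0.
  by rewrite ltr0_norm// mulrN mulNr lerDr expR_ge0.
have npos m x : (0 <= e%:E * (normal_pdf m 1 x)%:E)%E.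
  by rewrite -EFinM lee_fin mulr_ge0 ?expR_ge0 ?normal_pdf_ge0.
rewrite ge0_integralD//=; do ?by apply: measurable_funeM; exact: mpdf.
rewrite !ge0_integralZl_EFin//=; do ?by rewrite expR_ge0.
- by rewrite !integral_normal_pdf mule1 -EFinD ltry.
- by move=> x _; rewrite lee_fin normal_pdf_ge0.
- exact: mpdf.
- by move=> x _; rewrite lee_fin normal_pdf_ge0.
- exact: mpdf.
Qed.

(** The rounding up of [`|x|] to an integer costs a factor [expR (K * c)], which
    tends to 1 with [c]: this keeps infinite products under control. *)
Lemma nmean_expR_le (cmax : R) : 0 <= cmax -> exists2 K : R, 0 <= K &
  forall c, 0 <= c <= cmax ->
    (nmean (fun n => expR (c * n.+1%:R)) <= (expR (K * c))%:E)%E.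
Proof.
move=> cmax0; pose t := cmax + 1.
pose I := (\int[lebesgue_measure]_x (expR (t * `|x|) * normal_pdf 0 1 x)%:E)%E.
have I0 : (0 <= I)%E.
  apply: integral_ge0 => x _.
  by rewrite lee_fin mulr_ge0 ?expR_ge0 ?normal_pdf_ge0.
have Ifin : I \is a fin_num by rewrite ge0_fin_numE// integral_expR_normal.
have mg : measurable_fun [set: R]
    (fun x => (expR (t * `|x|) * normal_pdf 0 1 x)%:E).
  apply/measurable_EFinP/measurable_funM; last exact: measurable_normal_pdf.
  exact: measurable_expR_norm.
exists (expR t * fine I); first by rewrite mulr_ge0 ?expR_ge0 ?fine_ge0.
move=> c /andP[c0 cc]; set K := _ * fine I.
apply: (@le_trans _ _ (\int[lebesgue_measure]_x
    ((normal_pdf 0 1 x)%:E +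
     (c * expR t)%:E * (expR (t * `|x|) * normal_pdf 0 1 x)%:E))%E).
  apply: ge0_le_integral => //=.
  - by move=> x _; rewrite lee_fin mulr_ge0 ?expR_ge0 ?normal_pdf_ge0.
  - apply/measurable_EFinP/measurable_funM; last exact: measurable_normal_pdf.
    exact: (measurable_truncn_norm (fun n => expR (c * n.+1%:R))).
  - apply: emeasurable_funD; last exact: measurable_funeM.
    by apply/measurable_EFinP; exact: measurable_normal_pdf.
  (* expR (c * m) - 1 <= c * m * expR (c * m), where m <= expR m *)
  move=> x _; rewrite -!EFinM -EFinD lee_fin mulrA.
  rewrite -[X in _ <= X + _]mul1r -mulrDl ler_wpM2r ?normal_pdf_ge0//.
  set m := (Num.truncn `|x|).+1%:R.
  have m0 : 0 <= m by exact: ler0n.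
  have mx : m <= `|x| + 1 by rewrite /m -natr1 lerD2r truncn_le.
  rewrite -lerBlDl; apply: le_trans (expR_subr1_le _) _.
  rewrite -!mulrA ler_wpM2l// -expRD.
  have me : m <= expR m.
    by apply: le_trans (expR_ge1Dx m); rewrite lerDr.
  apply: (@le_trans _ _ (expR m * expR (c * m))).
    by rewrite ler_wpM2r ?expR_ge0.
  rewrite -expRD ler_expR /t.
  have : c * m <= cmax * (`|x| + 1) by rewrite ler_pM.
  by lra.
rewrite ge0_integralD//=; last 4 first.
- by move=> x _; rewrite lee_fin normal_pdf_ge0.
- by apply/measurable_EFinP; exact: measurable_normal_pdf.
- move=> x _; rewrite -EFinM lee_fin.
  by rewrite !mulr_ge0 ?expR_ge0 ?normal_pdf_ge0.
- exact: measurable_funeM.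
rewrite integral_normal_pdf ge0_integralZl_EFin//=; last 2 first.
- by move=> x _; rewrite lee_fin mulr_ge0 ?expR_ge0 ?normal_pdf_ge0.
- by rewrite mulr_ge0 ?expR_ge0.
rewrite -/I -(fineK Ifin) -EFinM -EFinD lee_fin.
apply: le_trans (expR_ge1Dx _); rewrite lerD2l /K.
by rewrite le_eqVlt; apply/orP; left; apply/eqP; ring.
Qed.

End normal_cells.

Section independent_moments.
Context d (T : measurableType d) (R : realType) (gamma : probability T R).
Context (X : nat -> T -> R).
Local Notation N01 := (normal_prob (0 : R) 1).
Hypothesis mX : forall i, measurable_fun setT (X i).
Hypothesis iidX : forall k (B : nat -> set R), (forall i, measurable (B i)) ->
  gamma [set t | forall i, (i < k)%N -> B i (X i t)] =
  (\prod_(i < k) N01 (B i))%E.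

Let pr (B : set R) : R := fine (N01 B).

Let prE B : measurable B -> N01 B = (pr B)%:E.
Proof. by move=> mB; rewrite fineK// fin_num_measure. Qed.

Let event m k (B : nat -> set R) : set T :=
  [set t | forall i, (m <= i < k)%N -> B i (X i t)].

Let measurable_event m k B : (forall i, measurable (B i)) ->
  measurable (event m k B).
Proof.
move=> mB; rewrite (_ : event m k B = \bigcap_(i in [set i | (m <= i < k)%N])
    (X i @^-1` B i)).
  apply: bigcap_measurableType => i _; rewrite -[Y in measurable Y]setTI.
  exact: mX.
by apply/seteqP; split => t h i; exact: h.
Qed.

Let prob_event0 k B : (forall i, measurable (B i)) ->
  gamma (event 0 k B) = (\prod_(0 <= i < k) pr (B i))%:E.
Proof.
move=> mB; rewrite (_ : event 0 k B =
  [set t | forall i, (i < k)%N -> B i (X i t)])//.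
rewrite iidX// big_mkord (big_morph EFin EFinM erefl).
by apply: eq_bigr => i _; exact: prE (mB i).
Qed.

(** For functions of the coordinates with countably many values, the product
    rule for events gives the product rule for expectations: conditions
    [B m (X m t)] are traded one at a time for factors
    [phi m (truncn `|X m t|)], by summing over the cells. *)
Lemma integral_prod_cells k (phi : nat -> nat -> R) (s : nat -> R) :
  (forall j n, 0 <= phi j n) -> (forall j, nmean (phi j) = (s j)%:E) ->
  forall m, (m <= k)%N -> forall B, (forall i, measurable (B i)) ->
  (\int[gamma]_(t in event m k B)
     (\prod_(j < m) phi j (Num.truncn `|X j t|))%:E =
   (\prod_(j < m) s j * \prod_(m <= i < k) pr (B i))%:E)%E.
Proof.
move=> phi0 phis; elim=> [_ B mB|m IH mk B mB].
  under eq_integral do rewrite big_ord0.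
  rewrite integral_cst; last exact: measurable_event.
  by rewrite mul1e big_ord0 mul1r; exact: prob_event0.
(* split the event according to the cell of X m, on which the factor of index m
   is constant *)
pose B' n i := if i == m then cell n else B i.
have mB' n i : measurable (B' n i).
  by rewrite /B'; case: ifP => // _; exact: measurable_cell.
have eventE : event m.+1 k B = \bigcup_n event m k (B' n).
  apply/seteqP; split => [t h|t [n _ h] i /andP[mi ik]].
    exists (Num.truncn `|X m t|) => // i /andP[mi ik]; rewrite /B'.
    case: eqP => [->//|/eqP im]; apply: h; rewrite ik andbT.
    by rewrite ltn_neqAle eq_sym im.
  by have := h i; rewrite /B' gtn_eqF// (ltnW mi) ik; exact.
have prod0 j t : 0 <= \prod_(i < j) phi i (Num.truncn `|X i t|).
  by apply: prodr_ge0.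
have mprod j : measurable_fun [set: T]
    (fun t => (\prod_(i < j) phi i (Num.truncn `|X i t|))%:E).
  apply/measurable_EFinP; apply: measurable_prod => i _.
  exact: (measurableT_comp (measurable_truncn_norm (phi i)) (mX i)).
rewrite eventE ge0_integral_bigcup; last 4 first.
- by move=> n; exact: measurable_event.
- exact: measurable_funTS.
- by move=> t _; rewrite lee_fin.
- move=> n1 n2 _ _ [t [/(_ m) h1 /(_ m) h2]].
  by move: h1 h2; rewrite leqnn mk/= /B' eqxx => <-// <-.
have -> : (\prod_(j < m.+1) s j * \prod_(m.+1 <= i < k) pr (B i))%:E =
    ((\prod_(j < m) s j * \prod_(m.+1 <= i < k) pr (B i))%:E *
     nmean (phi m))%E.
  by rewrite phis -EFinM big_ord_recr/= mulrAC.
rewrite nmeanE// -nneseriesZl; last first.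
  by move=> n _; rewrite mule_ge0// lee_fin.
apply: eq_eseriesr => n _.
transitivity (\int[gamma]_(t in event m k (B' n)) ((phi m n)%:E *
    (\prod_(j < m) phi j (Num.truncn `|X j t|))%:E))%E.
  apply: eq_integral => t /set_mem /(_ m).
  rewrite leqnn mk /B' eqxx/= => /(_ isT) tn.
  by rewrite big_ord_recr/= tn mulrC EFinM.
rewrite ge0_integralZl_EFin//; last 3 first.
- exact: measurable_event.
- by move=> t _; rewrite lee_fin.
- exact: measurable_funTS.
rewrite IH ?(ltnW mk)// (prE (measurable_cell n)) -!EFinM (big_ltn mk).
rewrite {1}/B' eqxx.
rewrite [\prod_(m.+1 <= i < k) pr (B' n i)](eq_big_nat _ _
  (F2 := fun i => pr (B i))); last first.
  by move=> i /andP[mi _]; rewrite /B' gtn_eqF.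
by congr EFin; ring.
Qed.

Lemma integral_prod_cellsT k (phi : nat -> nat -> R) (s : nat -> R) :
  (forall j n, 0 <= phi j n) -> (forall j, nmean (phi j) = (s j)%:E) ->
  (\int[gamma]_t (\prod_(j < k) phi j (Num.truncn `|X j t|))%:E =
   (\prod_(j < k) s j)%:E)%E.
Proof.
move=> phi0 phis.
have := integral_prod_cells phi0 phis (leqnn k) (fun=> measurableT).
rewrite big_geq// mulr1 => <-; congr (integral _ _ _).
by apply/seteqP; split.
Qed.

(** Each factor of the product contributes at most [expR (K * c j)]. *)
Lemma expectation_expR_le (cmax : R) : 0 <= cmax -> exists2 K : R, 0 <= K &
  forall c : nat -> R, (forall j, 0 <= c j <= cmax) -> forall k,
  (\int[gamma]_t (expR (\sum_(j < k) c j * `|X j t|))%:E <=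
   (expR (K * \sum_(j < k) c j))%:E)%E.
Proof.
move=> cmax0; have [K K0 nK] := nmean_expR_le cmax0; exists K => // c cc k.
pose phi j n := expR (c j * n.+1%:R).
have phi0 j n : 0 <= phi j n by exact: expR_ge0.
have n0 j : (0 <= nmean (phi j))%E.
  rewrite nmeanE//; apply: nneseries_ge0 => n _ _.
  by rewrite mule_ge0// lee_fin.
pose s j := fine (nmean (phi j)).
have phis j : nmean (phi j) = (s j)%:E.
  rewrite fineK// ge0_fin_numE//; apply: le_lt_trans (nK _ (cc j)) _.
  exact: ltry.
apply: (@le_trans _ _
    (\int[gamma]_t (\prod_(j < k) phi j (Num.truncn `|X j t|))%:E)%E).
  apply: ge0_le_integral => //.
  - apply/measurable_EFinP; apply: measurableT_comp => //.
    apply: measurable_sum => j; apply: measurable_funM => //.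
    exact: measurableT_comp.
  - apply/measurable_EFinP; apply: measurable_prod => j _.
    exact: (measurableT_comp (measurable_truncn_norm (phi j)) (mX j)).
  - move=> t _; rewrite lee_fin expR_sum; apply: ler_prod => j _.
    rewrite expR_ge0/= /phi ler_expR ler_wpM2l//.
      by have /andP[] := cc j.
    exact/ltW/truncnS_gt.
rewrite (integral_prod_cellsT _ phi0 phis) lee_fin mulr_sumr expR_sum.
apply: ler_prod => j _; rewrite -lee_fin -phis nK// andbT.
by rewrite /s fine_ge0.
Qed.

End independent_moments.

Section weighted_moments.
Context d (T : measurableType d) (R : realType) (gamma : probability T R).
Context (X : nat -> T -> R).
Hypothesis mX : forall i, measurable_fun setT (X i).

Lemma measurable_wtail (b : nat -> R) J : (forall i, 0 <= b i) ->
  measurable_fun setT (fun t => wtail b J (X ^~ t)).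
Proof.
move=> b0; under eq_fun do rewrite /wtail eseries_cond.
apply: ge0_emeasurable_sum => [i t _ _|i _].
  by rewrite lee_fin mulr_ge0.
apply/measurable_EFinP/measurable_funM => //.
exact: measurableT_comp.
Qed.

(** The expectation passes through the weighted series term by term. *)
Lemma integral_wtail_le (b : nat -> R) (Y : T -> R) (s M : R) :
  (forall i, 0 <= b i) -> (forall t, weighted_summable b (X ^~ t)) ->
  (forall k, \sum_(i < k) b i <= s) ->
  measurable_fun setT Y -> (forall t, 0 <= Y t) -> 0 <= M ->
  (forall i, \int[gamma]_t (`|X i t| * Y t)%:E <= M%:E)%E ->
  (\int[gamma]_t (fine (wtail b 0 (X ^~ t)) * Y t)%:E <= (s * M)%:E)%E.
Proof.
move=> b0 sb bs mY Y0 M0 XYM.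
have XY0 i t : 0 <= `|X i t| * Y t by rewrite mulr_ge0.
have mXY i : measurable_fun [set: T] (fun t => (`|X i t| * Y t)%:E).
  apply/measurable_EFinP/measurable_funM => //; exact: measurableT_comp.
rewrite (eq_integral (fun t => \sum_(0 <= i <oo)
    ((b i)%:E * (`|X i t| * Y t)%:E)))%E; last first.
  move=> t _; rewrite EFinM fineK ?wtail_fin_num// muleC /wtail -nneseriesZl.
    by apply: eq_eseriesr => i _; rewrite -!EFinM; congr EFin; ring.
  by move=> i _; rewrite lee_fin mulr_ge0.
rewrite integral_nneseries//; last 2 first.
- by move=> i; exact: measurable_funeM.
- by move=> i t _; rewrite -EFinM lee_fin mulr_ge0.
apply: lime_le.
  apply: is_cvg_nneseries => i _ _; apply: integral_ge0 => t _.
  by rewrite -EFinM lee_fin mulr_ge0.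
apply: nearW => k; apply: (@le_trans _ _ (\sum_(0 <= i < k) (b i * M)%:E)%E).
  apply: lee_sum => i _; rewrite ge0_integralZl_EFin//.
    by rewrite EFinM lee_wpmul2l// lee_fin.
  by move=> t _; rewrite lee_fin.
by rewrite sumEFin big_mkord lee_fin -mulr_suml ler_wpM2r.
Qed.

Local Notation N01 := (normal_prob (0 : R) 1).
Hypothesis iidX : forall k (B : nat -> set R), (forall i, measurable (B i)) ->
  gamma [set t | forall i, (i < k)%N -> B i (X i t)] =
  (\prod_(i < k) N01 (B i))%E.

Context (b : nat -> R) (s : R).
Hypothesis b0 : forall i, 0 <= b i.
Hypothesis bs : forall k, \sum_(i < k) b i <= s.
Hypothesis sb : forall t, weighted_summable b (X ^~ t).
Local Notation a0 t := (fine (wtail b 0 (X ^~ t))).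

Lemma measurable_expR_wsum q :
  measurable_fun [set: T] (fun t => expR (q * a0 t)).
Proof.
apply: measurableT_comp => //; apply: measurable_funM => //.
by apply: (measurableT_comp (@fine_measurable R setT measurableT));
  exact: measurable_wtail.
Qed.

Lemma cvg_wsum t : (fun k => \sum_(l < k) b l * `|X l t|) @ \oo --> a0 t.
Proof.
have := is_cvg_nneseries (u_ := fun i => (`|X i t| * b i)%:E) (P := xpredT)
  (N := 0).
move=> /(_ _)/cvg_ex[].
  by move=> i _ _; rewrite lee_fin mulr_ge0.
move=> l cl.
have le : wtail b 0 (X ^~ t) = l by exact/cvg_lim.
have fl : l \is a fin_num by rewrite -le wtail_fin_num.
move: cl; rewrite -(fineK fl) => /fine_cvg; rewrite -le.
apply: cvg_trans; apply: near_eq_cvg; apply: nearW => k /=.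
rewrite sumEFin/= big_mkord; apply: eq_bigr => i _; exact: mulrC.
Qed.

Lemma sum_indicator (y : nat -> R) i k : (i < k)%N ->
  \sum_(l < k) (l == i :> nat)%:R * y l = y i.
Proof.
move=> ik; rewrite (bigD1 (Ordinal ik))//= eqxx mul1r big1 ?addr0// => l li.
by rewrite (negbTE (li : (l : nat) != i)) mul0r.
Qed.

(** The bound is uniform in [i] and [j]: [`|X i|] and [`|X j|] are at most their
    exponentials, which only increases two of the weights in the exponential
    moment by 1. *)
Lemma expectation_product_expR_le q : 0 <= q -> exists2 M : R, 0 <= M &
  forall i j,
  (\int[gamma]_t (`|X i t| * (`|X j t| * expR (q * a0 t)))%:E <= M%:E)%E.
Proof.
move=> q0; have s0 : 0 <= s by have := bs 0; rewrite big_ord0.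
pose cmax := q * s + 2.
have cmax0 : 0 <= cmax by rewrite addr_ge0 ?mulr_ge0.
have [K K0 eK] := expectation_expR_le mX iidX cmax0.
exists (expR (K * cmax)); first exact: expR_ge0.
move=> i j; pose c l : R := q * b l + ((l == i)%:R + (l == j)%:R).
have bl l : b l <= s.
  apply: le_trans (bs l.+1); rewrite big_ord_recr/= lerDr.
  by apply: sumr_ge0.
have ind1 l m : 0 <= ((l == m :> nat)%:R : R) <= 1.
  by rewrite ler0n lern1 leq_b1.
have cc l : 0 <= c l <= cmax.
  have /andP[i0 i1] := ind1 l i; have /andP[j0 j1] := ind1 l j.
  have qb : q * b l <= q * s by rewrite ler_wpM2l.
  have qb0 : 0 <= q * b l by rewrite mulr_ge0.
  by rewrite /c /cmax; apply/andP; split; lra.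
have ind_sum m k : \sum_(l < k) ((l == m :> nat)%:R : R) <= 1.
  have [mk|km] := ltnP m k.
    rewrite -[leRHS](sum_indicator (fun=> 1) mk); apply: ler_sum => l _.
    by rewrite mulr1.
  rewrite big1 ?ler01// => l _.
  by rewrite (ltn_eqF (leq_trans (ltn_ord l) km)).
have csum k : \sum_(l < k) c l <= cmax.
  rewrite /c !big_split/= -mulr_sumr /cmax -[2]/(1 + 1).
  apply: lerD; first by rewrite ler_wpM2l ?bs.
  by apply: lerD; exact: ind_sum.
(* the exponential moment bounds the mean of f k for each k; the limit in k is
   taken by monotone convergence *)
pose f k t : \bar R := (expR (\sum_(l < k) c l * `|X l t|))%:E.
have cX0 l t : 0 <= c l * `|X l t|.
  by rewrite mulr_ge0//; have /andP[] := cc l.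
have mf k : measurable_fun [set: T] (f k).
  apply/measurable_EFinP; apply: measurableT_comp => //.
  apply: measurable_sum => l; apply: measurable_funM => //.
  exact: measurableT_comp.
have f0 k t : (0 <= f k t)%E by rewrite lee_fin expR_ge0.
have ndf t : nondecreasing_seq (f ^~ t).
  move=> m k mk; rewrite lee_fin ler_expR -(subnKC mk) big_split_ord/= lerDl.
  by apply: sumr_ge0.
have limf t : limn (f ^~ t) = (expR (`|X i t| + (`|X j t| + q * a0 t)))%:E.
  apply/cvg_lim => //; apply: cvg_EFin.
    by apply: nearW => k.
  apply: (@cvg_trans _ ((fun k => expR (`|X i t| + (`|X j t| +
      q * \sum_(l < k) b l * `|X l t|))) @ \oo)).
    apply: near_eq_cvg; near=> k => /=.
    have ik : (i < k)%N by near: k; exists i.+1.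
    have jk : (j < k)%N by near: k; exists j.+1.
    rewrite -{1}(sum_indicator (fun l => `|X l t|) ik).
    rewrite -{1}(sum_indicator (fun l => `|X l t|) jk).
    rewrite mulr_sumr -!big_split/=; congr expR.
    by apply: eq_bigr => l _; rewrite /c; ring.
  apply: continuous_cvg; first exact: continuous_expR.
  apply: cvgD; first exact: cvg_cst.
  apply: cvgD; first exact: cvg_cst.
  by apply: cvgM; [exact: cvg_cst|exact: cvg_wsum].
apply: (@le_trans _ _ (\int[gamma]_t (limn (f ^~ t)))%E).
  apply: ge0_le_integral => //.
  - apply/measurable_EFinP; apply: measurable_funM.
      exact: measurableT_comp.
    apply: measurable_funM; first exact: measurableT_comp.
    exact: measurable_expR_wsum.
  - apply: (emeasurable_fun_cvg f) => // t _.
    exact: ereal_nondecreasing_is_cvgn.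
  - move=> t _; rewrite limf lee_fin !expRD.
    have xe (x : R) : x <= expR x.
      by apply: le_trans (expR_ge1Dx x); rewrite lerDr.
    by rewrite ler_pM ?mulr_ge0 ?expR_ge0// ler_pM ?expR_ge0.
rewrite monotone_convergence//.
apply: lime_le.
  apply: ereal_nondecreasing_is_cvgn => m k mk; apply: ge0_le_integral => //.
  by move=> t _; exact: ndf.
apply: nearW => k; apply: le_trans (eK c cc k) _.
by rewrite lee_fin ler_expR ler_wpM2l.
Unshelve. all: by end_near.
Qed.

(** The square of the tail is a double series with terms
    [b i * b j * `|X i| * `|X j|]; summing the uniform bound on their
    expectations gives the square of the tail sum of [b]. *)
Lemma expectation_tail_le q : 0 <= q -> exists2 M : R, 0 <= M &
  forall J r, (forall k, \sum_(J <= i < k) b i <= r) ->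
  (\int[gamma]_t (fine (wtail b J (X ^~ t)) ^+ 2 * expR (q * a0 t))%:E <=
   (r ^+ 2 * M)%:E)%E.
Proof.
move=> q0; have [M M0 XM] := expectation_product_expR_le q0.
exists M => // J r br.
have r0 : 0 <= r by have := br J; rewrite big_geq.
pose bJ i := if (J <= i)%N then b i else 0.
have bJ0 i : 0 <= bJ i by rewrite /bJ; case: ifP.
have wJ t : wtail b J (X ^~ t) = wtail bJ 0 (X ^~ t).
  rewrite /wtail eseries_cond eseries_mkcondr; apply: eq_eseriesr => i _.
  by rewrite /bJ; case: ifP => // _; rewrite mulr0.
have sbJ t : weighted_summable bJ (X ^~ t).
  by move: (sb t); apply: le_lt_trans; rewrite -/(wtail bJ 0 _) -wJ wtail_le.
have bJr k : \sum_(i < k) bJ i <= r.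
  apply: le_trans (br k); rewrite -(big_mkord xpredT) -big_mkcond/=.
  by rewrite [leRHS](big_nat_widenl J 0).
have mw : measurable_fun [set: T] (fun t => fine (wtail bJ 0 (X ^~ t))).
  by apply: (measurableT_comp (@fine_measurable R setT measurableT));
    exact: measurable_wtail.
have w0 t : 0 <= fine (wtail bJ 0 (X ^~ t)) by rewrite fine_ge0// wtail_ge0.
have me := measurable_expR_wsum q.
have mnX i : measurable_fun [set: T] (fun t => `|X i t|).
  exact: measurableT_comp.
under eq_integral do rewrite wJ expr2 -mulrA.
rewrite expr2 -mulrA; apply: integral_wtail_le => //.
- exact: measurable_funM.
- by move=> t; rewrite mulr_ge0 ?expR_ge0.
- by rewrite mulr_ge0.
move=> i; under eq_integral do rewrite mulrCA.
apply: integral_wtail_le => //.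
exact: measurable_funM.
Qed.

(** The events [a0 t <= m] exhaust the space as [m] grows, so they cannot all be
    negligible. *)
Lemma wsum_bounded_event : exists2 m : R, measurable [set t | a0 t <= m] &
  (0 < gamma [set t | (a0 t <= m)%R])%E.
Proof.
pose A (n : nat) := [set t | a0 t <= n%:R].
have mA n : measurable (A n).
  rewrite (_ : A n = (fun t => a0 t) @^-1` [set` `]-oo, n%:R] ]).
    rewrite -[Y in measurable Y]setTI.
    have mw : measurable_fun [set: T] (fun t => a0 t).
      by apply: (measurableT_comp (@fine_measurable R setT measurableT));
        exact: measurable_wtail.
    by apply: mw => //; exact: measurable_itv.
  by apply/seteqP; split => t; rewrite /A/= in_itv.
apply: contrapT => noA.
have A0 n : gamma (A n) = 0.
  apply/eqP; rewrite eq_le measure_ge0 andbT leNgt; apply/negP => An.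
  by apply: noA; exists n%:R => //; exact: mA.
have AT : \bigcup_n A n = setT.
  rewrite -subTset => t _; exists (Num.truncn (a0 t)).+1 => //.
  exact/ltW/truncnS_gt.
have [B [mB B0 TB]] : gamma.-negligible (\bigcup_n A n).
  by apply: negligible_bigcup => n; exists (A n); split => //; exact: A0.
have : (gamma setT <= gamma B)%E.
  by apply: le_measure; rewrite ?inE//; move: TB; rewrite AT.
by rewrite [leLHS]probability_setT [leRHS]B0 lee_fin ler10.
Qed.

End weighted_moments.

(** * Stability of the Hellinger distance *)

Section hellinger_stability.
Context d (T : measurableType d) (R : realType) (gamma : probability T R).
Implicit Types (mu nu : probability T R) (w v H : T -> R).

Definition sqrt_density mu (t : T) : R := Num.sqrt (fine (density mu gamma t)).

Lemma sqrte_density mu t : mu `<< gamma ->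
  sqrte (density mu gamma t) = (sqrt_density mu t)%:E.
Proof.
move=> mug; have : density mu gamma t \is a fin_num.
  exact: Radon_Nikodym_fin_num.
by rewrite /sqrt_density; case: (density mu gamma t).
Qed.

Lemma measurable_density mu : mu `<< gamma ->
  measurable_fun [set: T] (density mu gamma).
Proof. by move=> mug; exact: measurable_int (Radon_Nikodym_integrable _). Qed.

Lemma measurable_sqrt_density mu : mu `<< gamma ->
  measurable_fun [set: T] (sqrt_density mu).
Proof.
move=> mug; apply: measurableT_comp.
  by apply: continuous_measurable_fun; exact: sqrt_continuous.
apply: (measurableT_comp (@fine_measurable R setT measurableT)).
exact: measurable_density.
Qed.

Lemma integral_sqrt_density_sqr mu w Z : mu `<< gamma ->
  (forall t, 0 <= w t) -> 0 < Z ->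
  {ae gamma, forall t, density mu gamma t = (w t / Z)%:E} ->
  (\int[gamma]_t (sqrt_density mu t ^+ 2)%:E = 1)%E.
Proof.
move=> mug w0 Z0 muw; transitivity (mu setT); last exact: probability_setT.
transitivity (\int[gamma]_t density mu gamma t)%E; last first.
  exact: (esym (@Radon_Nikodym_integral _ _ _ (charge_of_finite_measure mu)
    gamma setT mug measurableT)).
apply: ae_eq_integral => //.
- apply/measurable_EFinP/measurable_funX; exact: measurable_sqrt_density.
- exact: measurable_density.
apply: filterS muw => t muw _.
by rewrite /sqrt_density muw/= sqr_sqrtr// divr_ge0// ltW.
Qed.

(** A lower bound for an unnormalized density on an event bounds from below the
    normalization constant. *)
Lemma normalization_ge mu w Z A l : mu `<< gamma ->
  (forall t, 0 <= w t) -> 0 < Z ->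
  {ae gamma, forall t, density mu gamma t = (w t / Z)%:E} ->
  measurable A -> 0 <= l -> (forall t, A t -> l <= w t) ->
  l * fine (gamma A) <= Z.
Proof.
move=> mug w0 Z0 muw mA l0 lw.
have mF : measurable_fun [set: T] (fun t => (sqrt_density mu t ^+ 2)%:E).
  apply/measurable_EFinP/measurable_funX; exact: measurable_sqrt_density.
have F0 t : (0 <= (sqrt_density mu t ^+ 2)%:E)%E by rewrite lee_fin sqr_ge0.
have : ((l / Z)%:E * gamma A <= 1)%E.
  rewrite -(integral_sqrt_density_sqr mug w0 Z0 muw).
  apply: (@le_trans _ _ (\int[gamma]_(t in A) (sqrt_density mu t ^+ 2)%:E)%E).
    rewrite -integral_cst//; apply: ae_ge0_le_integral => //.
    - by move=> t _; rewrite lee_fin divr_ge0// ltW.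
    - exact: measurable_funTS.
    apply: filterS muw => t muw At; rewrite lee_fin.
    rewrite /sqrt_density muw/= sqr_sqrtr; last by rewrite divr_ge0// ltW.
    by rewrite ler_pM2r ?invr_gt0// lw.
  exact: ge0_subset_integral.
have Afin : gamma A \is a fin_num by exact: fin_num_measure.
by rewrite -(fineK Afin) -EFinM lee_fin mulrAC ler_pdivrMr// mul1r.
Qed.

(** Write [F], [G] for the square roots of the two densities, of unit norm, and
    [a], [b] for the square roots of the two normalization constants. The
    identity
      [(F - G)^2 + (a / b) F^2 + (b / a) G^2
       = (a F - b G)^2 / (a b) + F^2 + G^2]
    integrates, using [2 <= a / b + b / a], to the statement that normalizing
    two functions of norms [a] and [b] divides the square of their distance by
    at least [a b]. *)
Lemma hellinger_le mu nu w v H Zw Zv z h :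
  mu `<< gamma -> nu `<< gamma ->
  (forall t, 0 <= w t) -> (forall t, 0 <= v t) ->
  0 < z -> z <= Zw -> z <= Zv ->
  {ae gamma, forall t, density mu gamma t = (w t / Zw)%:E} ->
  {ae gamma, forall t, density nu gamma t = (v t / Zv)%:E} ->
  measurable_fun setT H ->
  (forall t, (Num.sqrt (w t) - Num.sqrt (v t)) ^+ 2 <= H t) ->
  (\int[gamma]_t (H t)%:E <= h%:E)%E ->
  (hellinger gamma mu nu <= (Num.sqrt (h / z))%:E)%E.
Proof.
move=> mug nug w0 v0 z0 zw zv muw nuv mH wvH Hh.
have Zw0 : 0 < Zw by exact: lt_le_trans zw.
have Zv0 : 0 < Zv by exact: lt_le_trans zv.
set a := Num.sqrt Zw; set b := Num.sqrt Zv.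
have a0 : 0 < a by rewrite sqrtr_gt0.
have b0 : 0 < b by rewrite sqrtr_gt0.
have zab : z <= a * b.
  have -> : z = Num.sqrt z * Num.sqrt z by rewrite -expr2 sqr_sqrtr// ltW.
  by rewrite ler_pM// ler_wsqrtr.
pose F := sqrt_density mu; pose G := sqrt_density nu.
have mF : measurable_fun [set: T] F by exact: measurable_sqrt_density.
have mG : measurable_fun [set: T] G by exact: measurable_sqrt_density.
have H0 t : 0 <= H t by apply: le_trans (wvH t); exact: sqr_ge0.
have IF : (\int[gamma]_t (F t ^+ 2)%:E = 1)%E.
  exact: integral_sqrt_density_sqr w0 Zw0 muw.
have IG : (\int[gamma]_t (G t ^+ 2)%:E = 1)%E.
  exact: integral_sqrt_density_sqr v0 Zv0 nuv.
pose X := (\int[gamma]_t ((F t - G t) ^+ 2)%:E)%E.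
have X0 : (0 <= X)%E by apply: integral_ge0 => t _; rewrite lee_fin sqr_ge0.
have h0 : 0 <= h.
  by rewrite -lee_fin (le_trans _ Hh)// integral_ge0// => t _; rewrite lee_fin.
have mF2 : measurable_fun [set: T] (fun t => (F t ^+ 2)%:E).
  exact/measurable_EFinP/measurable_funX.
have mG2 : measurable_fun [set: T] (fun t => (G t ^+ 2)%:E).
  exact/measurable_EFinP/measurable_funX.
have mFG2 : measurable_fun [set: T] (fun t => ((F t - G t) ^+ 2)%:E).
  exact/measurable_EFinP/measurable_funX/measurable_funB.
have mHe : measurable_fun [set: T] (fun t => (H t)%:E).
  exact/measurable_EFinP.
have sq0 (f : T -> R) t : (0 <= (f t ^+ 2)%:E)%E by rewrite lee_fin sqr_ge0.
have He0 t : (0 <= (H t)%:E)%E by rewrite lee_fin.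
have sqFG t : (0 <= ((F t - G t) ^+ 2)%:E)%E by rewrite lee_fin sqr_ge0.
have ab0 : 0 <= a / b by rewrite divr_ge0// ltW.
have ba0 : 0 <= b / a by rewrite divr_ge0// ltW.
have c0 : 0 <= (a * b)^-1 by rewrite invr_ge0 mulr_ge0// ltW.
have key : (X + ((a / b)%:E + (b / a)%:E) <=
    ((a * b)^-1 * h)%:E + (1 + 1))%E.
  apply: (@le_trans _ _ (\int[gamma]_t (((F t - G t) ^+ 2)%:E +
      ((a / b)%:E * (F t ^+ 2)%:E + (b / a)%:E * (G t ^+ 2)%:E)))%E).
    rewrite ge0_integralD//=; last 2 first.
    - by move=> t _; rewrite adde_ge0// mule_ge0.
    - by apply: emeasurable_funD; exact: measurable_funeM.
    rewrite ge0_integralD//=; last 4 first.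
    - by move=> t _; rewrite mule_ge0.
    - exact: measurable_funeM.
    - by move=> t _; rewrite mule_ge0.
    - exact: measurable_funeM.
    by rewrite !ge0_integralZl_EFin// IF IG !mule1.
  apply: (@le_trans _ _ (\int[gamma]_t ((a * b)^-1%:E * (H t)%:E +
      ((F t ^+ 2)%:E + (G t ^+ 2)%:E)))%E); last first.
    rewrite ge0_integralD//=; last 4 first.
    - by move=> t _; rewrite mule_ge0// lee_fin.
    - exact: measurable_funeM.
    - by move=> t _; rewrite adde_ge0.
    - exact: emeasurable_funD.
    rewrite ge0_integralD//= IF IG leeD2r// ge0_integralZl_EFin//.
    by rewrite EFinM lee_wpmul2l.
  apply: ae_ge0_le_integral => //=.
  - by move=> t _; rewrite !adde_ge0// mule_ge0.
  - by apply: emeasurable_funD => //; apply: emeasurable_funD;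
      exact: measurable_funeM.
  - by move=> t _; rewrite !adde_ge0// mule_ge0// lee_fin.
  - apply: emeasurable_funD; first exact: measurable_funeM.
    exact: emeasurable_funD.
  apply: filterS2 muw nuv => t muw nuv _.
  have Fw : F t = Num.sqrt (w t) / a.
    by rewrite /F /sqrt_density muw/= sqrtrM// sqrtrV// ltW.
  have Gv : G t = Num.sqrt (v t) / b.
    by rewrite /G /sqrt_density nuv/= sqrtrM// sqrtrV// ltW.
  rewrite -!EFinM -!EFinD lee_fin.
  have -> : (F t - G t) ^+ 2 + (a / b * F t ^+ 2 + b / a * G t ^+ 2) =
      (a * b)^-1 * (Num.sqrt (w t) - Num.sqrt (v t)) ^+ 2 +
      (F t ^+ 2 + G t ^+ 2).
    by rewrite Fw Gv; field; rewrite !gt_eqF.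
  by rewrite lerD2r ler_wpM2l.
have Xh : (X <= (h / z)%:E)%E.
  have amgm : 2 <= a / b + b / a.
    rewrite -subr_ge0 (_ : _ - _ = (a - b) ^+ 2 / (a * b)).
      by rewrite divr_ge0 ?sqr_ge0 ?mulr_ge0// ltW.
    by field; rewrite !gt_eqF.
  have hz : (a * b)^-1 * h <= h / z.
    by rewrite mulrC ler_wpM2l// lef_pV2 ?posrE ?mulr_gt0.
  move: key X0; rewrite /X; case: (integral _ _ _) => [x|//|//].
  by rewrite -!EFinD !lee_fin => key _; lra.
rewrite /hellinger -[leRHS]/(sqrte (h / z)%:E) lee_sqrt; last first.
  by rewrite lee_fin divr_ge0// ltW.
rewrite (eq_integral (fun t => ((F t - G t) ^+ 2)%:E)); last first.
  by move=> t _; rewrite !sqrte_density.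
rewrite -/X; apply: le_trans Xh.
rewrite -[leRHS]mul1e lee_wpmul2r// lee_fin.
by rewrite invf_le1// ler1n.
Qed.

End hellinger_stability.

(** * The prior and the decay of the weights *)

Section prior.
Context (R : realType) (b : nat -> R).
Context (P : probability (RN R) R) (gamma : probability (param_space b) R).
Hypothesis b0 : forall i, 0 <= b i.

Lemma measurable_coordRN i : measurable_fun [set: RN R] (fun u : RN R => u i).
Proof.
move=> _ B mB; rewrite setTI; apply: sub_sigma_algebra.
by exists i, B.
Qed.

Lemma measurable_param (B : set (RN R)) : measurable B ->
  measurable [set u : param_space b | B u].
Proof. by move=> mB; exists B => //; rewrite setTI. Qed.

Lemma measurable_coord i :
  measurable_fun [set: param_space b] (fun u : param_space b => u i).
Proof.
move=> _ B mB; rewrite setTI.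
apply: (@measurable_param [set u : RN R | B (u i)]).
by have := measurable_coordRN i measurableT mB; rewrite setTI.
Qed.

Lemma measurable_weighted_summable :
  measurable [set u : RN R | weighted_summable b u].
Proof.
have mw : measurable_fun [set: RN R] (fun u : RN R => wtail b 0 u).
  exact: (measurable_wtail measurable_coordRN 0 b0).
have := mw measurableT [set` `]-oo, (+oo%E : \bar R)[ ] (emeasurable_itv _).
by rewrite setTI; congr measurable; apply/seteqP; split => u; rewrite /= in_itv.
Qed.

Hypothesis gaussP : std_gaussian_product P.
Hypothesis gammaP : restricted_prior P gamma.

(** The prior being a probability, the summable sequences have full measure for
    the product Gaussian, so that restricting to them changes no probability. *)
Lemma prior_cylinder k (B : nat -> set R) : (forall i, measurable (B i)) ->
  gamma [set u | forall i, (i < k)%N -> B i (u i)] =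
  (\prod_(i < k) normal_prob (0 : R) 1 (B i))%E.
Proof.
move=> mB; rewrite -(gaussP k mB).
set E : set (RN R) := [set u | forall i, (i < k)%N -> B i (u i)].
have mE : measurable E.
  rewrite (_ : E = \bigcap_(i in [set i | (i < k)%N])
      ((fun u : RN R => u i) @^-1` B i)).
    apply: bigcap_measurableType => i _; rewrite -[Y in measurable Y]setTI.
    by apply: measurable_coordRN => //; exact: mB.
  by apply/seteqP; split => u h i; exact: h.
have mU := measurable_weighted_summable.
have PU : P [set u : RN R | weighted_summable b u] = 1%E.
  rewrite -(probability_setT gamma) -[X in P X]setTI.
  by rewrite -(gammaP (@measurableT _ (RN R))); congr (gamma _); apply/seteqP.
transitivity (P (E `&` [set u : RN R | weighted_summable b u])).
  exact: gammaP mE.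
rewrite [RHS](measureDI _ mE mU).
rewrite [X in (X + _)%E](_ : _ = 0%E) ?add0e//.
apply/eqP; rewrite eq_le measure_ge0 andbT.
apply: (@le_trans _ _ (P (~` [set u : RN R | weighted_summable b u]))).
  apply: le_measure; rewrite ?inE; last by move=> u [].
  - exact: measurableD.
  - exact: measurableC.
by rewrite probability_setC// PU subee.
Qed.

End prior.

Section power_tail.
Context (R : realType) (p : R).
Hypothesis p1 : 1 < p.

(** Comparison of [(i + 1)^(-p)] with the increment of a primitive of [x^(-p)];
    it reduces to [1 + x <= expR x] and [ln (1 + x) <= x] at the ratio
    [i / (i + 1)]. *)
Lemma powR_increment_ge (i : nat) : (0 < i)%N ->
  (p - 1) * i.+1%:R `^ (- p) <= i%:R `^ (1 - p) - i.+1%:R `^ (1 - p).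
Proof.
move=> i0; have iR : 0 < i%:R :> R by rewrite ltr0n.
have i1R : 0 < i.+1%:R :> R by rewrite ltr0n.
have p0 : 0 < p - 1 by rewrite subr_gt0.
set x : R := i.+1%:R in i1R *.
have -> : x `^ (- p) = x `^ (1 - p) * x^-1.
  rewrite -powR_inv1 ?ltW// -powRD; last by apply/implyP => _; rewrite gt_eqF.
  by congr (_ `^ _); ring.
have -> : i%:R `^ (1 - p) = x `^ (1 - p) * (i%:R / x) `^ (1 - p).
  rewrite -powRM ?ltW// ?divr_gt0//.
  by congr (_ `^ _); rewrite mulrC divfK// gt_eqF.
rewrite -{3}[x `^ (1 - p)]mulr1 -mulrBr mulrCA ler_wpM2l ?powR_ge0//.
have ix : i%:R / x = 1 - x^-1.
  by rewrite /x -natr1; field; rewrite natr1 gt_eqF.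
have ix0 : 0 < i%:R / x by rewrite divr_gt0.
rewrite /powR gt_eqF//.
have lnix : ln (i%:R / x) <= - x^-1.
  by rewrite ix; apply: le_ln1Dx; rewrite ltrN2 -subr_gt0 -ix.
have plnix : (p - 1) * x^-1 <= (1 - p) * ln (i%:R / x).
  have := ler_wpM2l (ltW p0) lnix.
  rewrite (_ : (1 - p) * _ = - ((p - 1) * ln (i%:R / x))); last by ring.
  by rewrite mulrN lerNr.
rewrite lerBrDl; apply: le_trans (expR_ge1Dx _).
by rewrite lerD2l.
Qed.

Lemma sum_powR_tail_le (J k : nat) : (0 < J)%N ->
  \sum_(J <= i < k) i.+1%:R `^ (- p) <= J%:R `^ (1 - p) / (p - 1).
Proof.
move=> J0; have p0 : 0 < p - 1 by rewrite subr_gt0.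
rewrite ler_pdivlMr// mulrC mulr_sumr.
have [kJ|Jk] := leqP k J; first by rewrite big_geq// powR_ge0.
apply: (@le_trans _ _
    (\sum_(J <= i < k) (i%:R `^ (1 - p) - i.+1%:R `^ (1 - p)))).
  rewrite !big_nat; apply: ler_sum => i /andP[Ji _].
  exact/powR_increment_ge/(leq_trans J0).
have -> : \sum_(J <= i < k) (i%:R `^ (1 - p) - i.+1%:R `^ (1 - p)) =
    - (k%:R `^ (1 - p) - J%:R `^ (1 - p)).
  rewrite -(telescope_sumr (fun i => i%:R `^ (1 - p) : R) (ltnW Jk)) -sumrN.
  by apply: eq_bigr => i _; rewrite opprB.
by rewrite opprB lerBlDr lerDl powR_ge0.
Qed.

End power_tail.

(** * The error of the truncated posterior *)

Lemma forward_mapE (R : realType) (n : nat) (Omega : set 'rV[R]_n.+1) x0 N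
    (pts : 'I_N -> 'rV[R]_n.+1) f k : forward_map Omega x0 pts f ord0 k =
  travel_time Omega x0 (continuous_rep Omega f) (pts k).
Proof. by rewrite mxE. Qed.

Theorem lemma3p2 (R : realType) (n : nat)
    (Omega : set 'rV[R]_n.+1) (x0 : 'rV[R]_n.+1)
    (s_star s_bar : 'rV[R]_n.+1 -> R) (psi : nat -> 'rV[R]_n.+1 -> R)
    (c p : R)
    (P : probability (RN R) R)
    (gamma : probability (param_space (psi_norm Omega psi)) R)
    (N : nat) (pts : 'I_N -> 'rV[R]_n.+1) (Sigma : 'M[R]_N) :
  bounded_lipschitz_domain Omega -> Omega x0 ->
  Linfty (lebesgue_rV R n.+1) Omega s_star ->
  Linfty (lebesgue_rV R n.+1) Omega s_bar ->
  (forall i, Linfty (lebesgue_rV R n.+1) Omega (psi i)) ->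
  {ae lebesgue_rV R n.+1, forall x, Omega x -> 0 <= s_star x} ->
  0 < c -> 1 < p ->
  (forall i, psi_norm Omega psi i < c * (i.+1)%:R `^ (- p)) ->
  (forall u : param_space (psi_norm Omega psi), exists g,
     is_continuous_rep Omega (slowness s_star s_bar psi u) g /\
     forall x, closure Omega x -> 0 < g x) ->
  std_gaussian_product P -> restricted_prior P gamma ->
  (forall k, closure Omega (pts k)) ->
  posdefmx Sigma ->
  forall r : R, 0 < r ->
  exists C : R, 0 < C /\
  forall (delta : 'rV[R]_N) (J : nat), enorm delta < r -> (0 < J)%N ->
  forall gamma_delta gammaJ_delta : probability (param_space (psi_norm Omega psi)) R,
    density_prop_to gamma gamma_delta
      (fun u => expR (- misfit Sigma
         (forward_map Omega x0 pts (slowness s_star s_bar psi u)) delta)) ->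
    density_prop_to gamma gammaJ_delta
      (fun u => expR (- misfit Sigma
         (forward_map Omega x0 pts (slowness_trunc s_star s_bar psi J u)) delta)) ->
    (hellinger gamma gammaJ_delta gamma_delta <=
       (C * J%:R `^ (- (p - 1)))%:E)%E.
Proof.
move=> [oO _ _ _ _] _ _ _ psiL s_star0 c0 p1 bc slow_rep gaussP gammaP _ _ r r0.
set b := psi_norm Omega psi in gamma bc slow_rep gammaP *.
have b0 i : 0 <= b i by exact: psi_norm_ge0.
have p10 : 0 < p - 1 by rewrite subr_gt0.
have cp0 : 0 <= c / (p - 1) by rewrite divr_ge0// ltW.
pose X (i : nat) (u : param_space b) : R := u i.
have mX i : measurable_fun setT (X i) by exact: measurable_coord.
have iidX k (B : nat -> set R) : (forall i, measurable (B i)) ->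
    gamma [set t | forall i, (i < k)%N -> B i (X i t)] =
    (\prod_(i < k) normal_prob (0 : R) 1 (B i))%E.
  exact: (prior_cylinder b0 gaussP gammaP).
have sb (u : param_space b) : weighted_summable b (X ^~ u).
  exact: param_summable.
have btail J k : (0 < J)%N ->
    \sum_(J <= i < k) b i <= c / (p - 1) * J%:R `^ (- (p - 1)).
  move=> J0; rewrite opprB -mulrA [X in _ * X]mulrC.
  apply: le_trans (ler_wpM2l (ltW c0) (sum_powR_tail_le p1 k J0)).
  by rewrite mulr_sumr; apply: ler_sum => i _; exact/ltW/bc.
have bs k : \sum_(i < k) b i <= c + c / (p - 1).
  case: k => [|k].
    by rewrite big_ord0 addr_ge0// ltW.
  rewrite -(big_mkord xpredT) big_ltn// lerD//.
    by apply: le_trans (ltW (bc 0)) _; rewrite powR1 mulr1.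
  by have := btail 1 k.+1 isT; rewrite powR1 mulr1.
(* the travel times differ by a multiple of aJ * expR (2 * a0), the misfits gain
   one more factor expR a0, and squaring yields the exponent 6 *)
have [M M0 tailM] := expectation_tail_le mX iidX b0 bs sb (ler0n R 6).
have [m mA A0] := wsum_bounded_event gamma mX b0.
set A := [set t | _] in mA A0.
pose tau (u : param_space b) k :=
  travel_time Omega x0 (continuous_rep Omega (slowness s_star s_bar psi u))
    (pts k).
pose t0 := \sum_(k < N) tau (param0 Omega psi) k.
have tau0 u k : 0 <= tau u k by exact: travel_time_slowness_ge0.
have t00 : 0 <= t0 by apply: sumr_ge0.
have tau0_le k : tau (param0 Omega psi) k <= t0.
  by rewrite /t0 (bigD1 k)//= lerDl; apply: sumr_ge0.
pose a0 u := fine (wtail b 0 (X ^~ u)).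
pose aJ J u := fine (wtail b J (X ^~ u)).
have a00 u : 0 <= a0 u by rewrite fine_ge0// wtail_ge0.
have ea0 u : 1 <= expR (a0 u) by rewrite -expR0 ler_expR.
(* K bounds the variation of the square root of the likelihood, in units of
   aJ * expR (3 * a0), and z is a lower bound for the normalization constants *)
pose Q := mx_gain (inv_sqrtmx Sigma).
have Q0 : 0 <= Q by exact: mx_gain_ge0.
pose K := t0 * (r + t0) * Q.
have K0 : 0 <= K by rewrite !mulr_ge0// addr_ge0// ltW.
pose z := expR (- (((r + t0) * expR m) ^+ 2 * Q)) * fine (gamma A).
have z0 : 0 < z.
  rewrite mulr_gt0 ?expR_gt0// fine_gt0// A0/=.
  by apply: le_lt_trans (probability_le1 _ mA) _; rewrite ltry.
(* the summand 1 makes the constant positive *)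
exists (1 + K * (c / (p - 1)) * Num.sqrt (M / z)); split.
  by rewrite ltr_wpDr// mulr_ge0 ?sqrtr_ge0// mulr_ge0.
move=> delta J deltar J0 nu mu [nug [Zv [Zv0 nuv]]] [mug [Zw [Zw0 muw]]].
pose uJ (u : param_space b) : param_space b :=
  @param_truncate R n Omega psi J u.
have truncE (u : param_space b) :
    slowness_trunc s_star s_bar psi J u = slowness s_star s_bar psi (uJ u).
  exact: slowness_truncE.
have dG u k t : 0 <= t -> t <= expR (a0 u) * tau (param0 Omega psi) k ->
    `|delta ord0 k - t| <= (r + t0) * expR (a0 u).
  move=> t_ge0 tle; apply: le_trans (ler_normB _ _) _.
  rewrite (ger0_norm t_ge0) mulrDl lerD//.
    apply: le_trans (normr_le_enorm _ _) _; apply: le_trans (ltW deltar) _.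
    by rewrite ler_peMr// ltW.
  by apply: le_trans tle _; rewrite mulrC ler_wpM2r ?expR_ge0.
have dGu (u : param_space b) k : `|delta ord0 k - forward_map Omega x0 pts
    (slowness s_star s_bar psi u) ord0 k| <= (r + t0) * expR (a0 u).
  by rewrite forward_mapE; apply: dG; [exact: tau0|exact: travel_time_le0].
have dGJ (u : param_space b) k : `|delta ord0 k - forward_map Omega x0 pts
    (slowness s_star s_bar psi (uJ u)) ord0 k| <= (r + t0) * expR (a0 u).
  rewrite forward_mapE; apply: dG; first exact: tau0.
  exact: travel_time_truncate_le0.
have GGJ (u : param_space b) k :
    `|forward_map Omega x0 pts (slowness s_star s_bar psi (uJ u)) ord0 k -
      forward_map Omega x0 pts (slowness s_star s_bar psi u) ord0 k| <=
    aJ J u * expR (a0 u) ^+ 2 * t0.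
  have D := travel_time_truncate_dist x0 oO psiL s_star0 slow_rep J u (pts k).
  rewrite distrC [X in `|X - _|]forward_mapE [X in `|_ - X|]forward_mapE.
  apply: le_trans D _.
  have ae0 : 0 <= aJ J u * expR (a0 u) ^+ 2.
    by rewrite mulr_ge0 ?sqr_ge0// fine_ge0// wtail_ge0.
  exact: (ler_wpM2l ae0 (tau0_le k)).
pose w (u : param_space b) := expR (- misfit Sigma (forward_map Omega x0 pts
  (slowness_trunc s_star s_bar psi J u)) delta).
pose v (u : param_space b) := expR (- misfit Sigma (forward_map Omega x0 pts
  (slowness s_star s_bar psi u)) delta).
have w0 u : 0 <= w u by exact: expR_ge0.
have v0 u : 0 <= v u by exact: expR_ge0.
have lower (u : param_space b) (G : 'rV[R]_N) : A u ->
    (forall k, `|delta ord0 k - G ord0 k| <= (r + t0) * expR (a0 u)) ->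
    expR (- (((r + t0) * expR m) ^+ 2 * Q)) <= expR (- misfit Sigma G delta).
  move=> Au dGk; rewrite ler_expR lerN2; apply: misfit_le => k.
  apply: le_trans (dGk k) _.
  by rewrite ler_wpM2l ?ler_expR// addr_ge0// ltW.
have zw : z <= Zw.
  apply: (normalization_ge mug w0 Zw0 muw mA (expR_ge0 _)) => u Au.
  by rewrite /w truncE; exact: lower (dGJ u).
have zv : z <= Zv.
  apply: (normalization_ge nug v0 Zv0 nuv mA (expR_ge0 _)) => u Au.
  exact: lower (dGu u).
pose H (u : param_space b) := K ^+ 2 * (aJ J u ^+ 2 * expR (6%:R * a0 u)).
have mH0 : measurable_fun [set: param_space b]
    (fun u => aJ J u ^+ 2 * expR (6%:R * a0 u)).
  apply: measurable_funM; last exact: (measurable_expR_wsum mX b0).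
  apply: measurable_funX.
  by apply: (measurableT_comp (@fine_measurable R setT measurableT));
    exact: (measurable_wtail mX).
have wvH u : (Num.sqrt (w u) - Num.sqrt (v u)) ^+ 2 <= H u.
  have D := sqrt_likelihood_dist Sigma (dGJ u) (dGu u) (GGJ u).
  rewrite /w /v truncE; apply: le_trans D _.
  rewrite /H expRM_natl le_eqVlt; apply/orP; left; apply/eqP.
  by rewrite -/Q /K; ring.
pose rJ := c / (p - 1) * J%:R `^ (- (p - 1)).
have Hh : (\int[gamma]_u (H u)%:E <= (K ^+ 2 * (rJ ^+ 2 * M))%:E)%E.
  under eq_integral do rewrite /H EFinM.
  rewrite ge0_integralZl_EFin; last 4 first.
  - exact: measurableT.
  - by move=> u _; rewrite lee_fin mulr_ge0 ?sqr_ge0 ?expR_ge0.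
  - exact/measurable_EFinP.
  - exact: sqr_ge0.
  rewrite [leRHS]EFinM; apply: lee_wpmul2l; first by rewrite lee_fin sqr_ge0.
  by apply: tailM => k; exact: btail.
have mH : measurable_fun [set: param_space b] H by exact: measurable_funM.
apply: le_trans (hellinger_le mug nug w0 v0 z0 zw zv muw nuv mH wvH Hh) _.
have rJ0 : 0 <= rJ by rewrite mulr_ge0 ?powR_ge0.
rewrite lee_fin (_ : K ^+ 2 * (rJ ^+ 2 * M) / z = (K * rJ) ^+ 2 * (M / z));
  last by field; rewrite gt_eqF.
rewrite sqrtrM ?sqr_ge0// sqrtr_sqr (ger0_norm (mulr_ge0 K0 rJ0)).
have -> : K * rJ * Num.sqrt (M / z) =
    K * (c / (p - 1)) * Num.sqrt (M / z) * J%:R `^ (- (p - 1)).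
  by rewrite /rJ; ring.
by rewrite [leRHS]mulrDl mul1r lerDr powR_ge0.
Qed.
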